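(* For every $\rho_0\in(0,1)$ there exists $\varepsilon_0>0$ such that the following holds. Let $Z$ be a finite abelian group and let $f:Z\to\mathbb{C}$ be a 1-bounded function. Then there exist $\rho\in[\rho_0/2,\rho_0]$ and $\varepsilon\in[\varepsilon_0,1]$ with the following property. Let $f_{\mathrm{reg}}$ be the orthogonal projection of $f$ to the linear span of the eigenspaces of $\mathcal{K}_\varepsilon(f\otimes\overline{f})$ with corresponding eigenvalues at least $\rho$. Then $\|f-f_{\mathrm{reg}}\|_{U^3}\le 2\rho^{3/8}$, and there exists $h:Z\to\mathbb{C}$ such that $\|f_{\mathrm{reg}}-h\|_2\le\rho$ and $\|h\|_{U^3}^*=O_\rho(1)$.
   Context: $Z$ is a finite abelian group with dual group $\widehat{Z}$; $\mathbb{E}_{x\in Z}$ is the average over $Z$. On $\mathbb{C}^Z$ use $\langle f,g\rangle=\mathbb{E}_{x\in Z}f(x)\overline{g(x)}$, $\|f\|_2=\langle f,f\rangle^{1/2}$, and $\widehat{f}(\chi)=\mathbb{E}_{x}f(x)\overline{\chi(x)}$ for $\chi\in\widehat{Z}$. A function is 1-bounded if $|f|\le 1$ everywhere. Fourier denoising operator: for $\varepsilon>0$ and $f\in\mathbb{C}^Z$, $K_\varepsilon(f)=\sum_{\chi\in\widehat Z:|\widehat f(\chi)|\ge\varepsilon}\frac{|\widehat f(\chi)|-\varepsilon}{|\widehat f(\chi)|}\widehat f(\chi)\chi$. For a matrix $M\in\mathbb{C}^{Z\times Z}$ and $t\in Z$ let $\mathfrak{D}_{M,t}:Z\to\mathbb{C}$,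 $z\mapsto M(z+t,z)$. The matrix $\mathcal{K}_\varepsilon(M)\in\mathbb{C}^{Z\times Z}$ is obtained by applying $K_\varepsilon$ to every such diagonal function: $\mathcal{K}_\varepsilon(M)(z+t,z)=K_\varepsilon(\mathfrak{D}_{M,t})(z)$. Also $(f\otimes\overline f)(x,y)=f(x)\overline{f(y)}$. The matrix $\mathcal{K}_\varepsilon(f\otimes\overline f)$ is self-adjoint. Matrices act in normalized form: $(Mv)(x)=\mathbb{E}_{y\in Z}M(x,y)v(y)$; $v\neq 0$ is an eigenvector of $M$ with eigenvalue $\lambda$ if $\mathbb{E}_{y\in Z}M(x,y)v(y)=\lambda v(x)$ for all $x$. Gowers norms: $\|f\|_{U^k}=\big(\mathbb{E}_{x,t_1,\dots,t_k\in Z}\prod_{v\in\{0,1\}^k}\mathcal{C}^{|v|}f(x+v_1t_1+\cdots+v_kt_k)\big)^{1/2^k}$, where $\mathcal{C}$ is complex conjugation and $|v|=\sum_i v_i$. Dual norm: $\|f\|_{U^k}^*=\sup\{|\langle f,g\rangle|:g\in\mathbb{C}^Z,\ \|g\|_{U^k}\le1\}$. $O_\rho(1)$ denotes a quantity bounded above by a constant depending only on $\rho$ (not on $Z$ or $f$). *)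

(* Defs.v *)
From HB Require Import structures.
From mathcomp Require Import all_boot all_order all_algebra.
From mathcomp Require Import complex.
From mathcomp Require Import all_classical all_reals all_analysis.

Set Implicit Arguments.
Unset Strict Implicit.
Unset Printing Implicit Defensive.

Import Order.TTheory GRing.Theory Num.Theory.
Import ComplexField.Normc.

Local Open Scope classical_set_scope.
Local Open Scope ring_scope.
Local Open Scope complex_scope.

Section GowersFourier.
Variable R : realType.
Local Notation C := R[i].

Definition avg (T : finType) (F : T -> C) : C := (#|T|%:R)^-1 * \sum_(t : T) F t.

Variable Z : finZmodType.
Implicit Types (f g h v chi : Z -> C) (M : Z -> Z -> C).

Definition one_bounded f : Prop := forall x, `|f x| <= 1.

Definition inner f g : C := avg (fun x => f x * (g x)^*).

Definition norm2 f : R := Num.sqrt (complex.Re (inner f f)).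

(* The dual group, as the set of homomorphisms from Z to the unit circle. *)
Definition dual_group : set (Z -> C) :=
  [set chi | (forall x, `|chi x| = 1) /\ {morph chi : x y / x + y >-> x * y}].

Definition fourier f chi : C := inner f chi.

(* The sum is a finitely supported sum ([fsbigop]) over a subset of the dual
   group, which is a finite set. *)
Definition denoise (eps : R) f : Z -> C := fun x =>
  \sum_(chi \in dual_group `&` [set chi | eps <= normc (fourier f chi)])
    ((normc (fourier f chi) - eps) / normc (fourier f chi))%:C
      * fourier f chi * chi x.

Definition diagonal M (t : Z) : Z -> C := fun z => M (z + t) z.

(* The entry (x, y) lies on the diagonal t = x - y, at position z = y. *)
Definition denoise_mx (eps : R) M : Z -> Z -> C :=
  fun x y => denoise eps (diagonal M (x - y)) y.

Definition tensor_conj f : Z -> Z -> C := fun x y => f x * (f y)^*.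

Definition eigenspace_fun M (lambda : C) : set (Z -> C) :=
  [set v | forall x, avg (fun y => M x y * v y) = lambda * v x].

Definition linear_span (S : set (Z -> C)) : set (Z -> C) :=
  [set v | exists (n : nat) (c : 'I_n -> C) (w : 'I_n -> Z -> C),
     (forall i, S (w i)) /\ (forall x, v x = \sum_(i < n) c i * w i x)].

Definition is_orthogonal_projection (V : set (Z -> C)) f g : Prop :=
  V g /\ forall v, V v -> inner (f \- g) v = 0.

(* Only real eigenvalues are considered: this is meant for self-adjoint M. *)
Definition spectral_space M (rho : R) : set (Z -> C) :=
  linear_span (\bigcup_(lambda in [set l : R | rho <= l])
                 eigenspace_fun M lambda%:C).

(* For k >= 1 the average is a nonnegative real number, so that taking its real
   part is only a change of type. *)
Definition gowers_norm (k : nat) f : R :=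
  complex.Re (avg (fun p : Z * {ffun 'I_k -> Z} =>
    \prod_(v : {ffun 'I_k -> bool})
      iter (\sum_(i < k) v i) conjc (f (p.1 + \sum_(i < k) p.2 i *+ v i))))
  `^ ((2 ^+ k)^-1).

(* The supremum is taken in the extended reals since [sup] is 0 on unbounded
   sets. *)
Definition gowers_dual_norm (k : nat) f : \bar R :=
  ereal_sup [set (normc (inner f g))%:E | g in [set g | gowers_norm k g <= 1]].

End GowersFourier.

(* Main.v *)
(* Let N(x, y) = f(x) conj(f(y)), A = K_eps(N), and write N = A + E + B, where a
   pigeonhole over a rapidly decreasing sequence of values of eps makes E small in
   Hilbert-Schmidt norm and all Fourier coefficients of all diagonals of B tiny
   compared to eps.  A product of B with a polynomial in A still has tiny
   coefficients, because the coefficients of each diagonal of A have l^1 norm at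
   most 1 / eps.  Testing the decomposition against A (1 - A)^(2k) shows that A has
   no eigenvalue much below 0.  A second pigeonhole gives a window [a, b) of
   eigenvalues on which f has little mass; put rho = b.  Then f - f_reg is close in
   L^2 to T f, where T = (1 - A^(2n))^m, and T N T = T A T + T E T + T B T is a
   decomposition of the same shape with T A T <= rho.  Let V(t, chi) be the
   coefficients of T N T, so that the eighth power of the U^3 norm of T f is
   X = E_t sum_chi |V|^4.  Up to small errors, X is at most the geometric mean of
   Y = |T A T|_HS^2 <= <A T f, T f> <= rho and of E_t sum_chi |V|^6 <= rho^2 X, so
   X = O(rho^3).  The bound on the sixth moment comes from replacing T N T by T A T
   twice in |<g, U g>|^2 = <T N T U g, U g>, for g = T f and U a Weyl operator.
   For the structured part one can take h = f_reg = A w: the coefficients of A are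
   supported where those of N are at least eps, and Cauchy-Schwarz on the cube
   bounds <A w, g> by |g|_{U^3} |w|_{U^3} / eps. *)

Require Import Defs.
From HB Require Import structures.
From mathcomp Require Import all_boot all_order all_algebra.
From mathcomp Require Import complex.
From mathcomp Require Import all_classical all_reals all_analysis.
From mathcomp Require Import ring lra.
Import Order.TTheory GRing.Theory Num.Theory.
Local Open Scope ring_scope.

Set Implicit Arguments.
Unset Strict Implicit.
Unset Printing Implicit Defensive.

(** * Averages and the Hilbert space of functions on a finite set *)

Section Basics.
Import ComplexField.Normc.
Variable R : realType.
Local Notation C := (complex R).
Local Notation "x %:C" := (real_complex R x) : ring_scope.

Lemma normcE_norm (x : C) : (normc x)%:C = `|x|.
Proof. by case: x. Qed.

Lemma normc_ge0 (x : C) : 0 <= normc x.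
Proof. by case: x => a b; rewrite sqrtr_ge0. Qed.

Lemma normc_conj (x : C) : normc (x^*) = normc x.
Proof. by rewrite -[x^*]/(conjc x); case: x => a b /=; rewrite sqrrN. Qed.

Lemma conjC_real (r : R) : (r%:C)^* = r%:C.
Proof. exact: conjc_real. Qed.

Lemma normc_sqr (x : C) : ((normc x) ^+ 2)%:C = x * x^*.
Proof. by rewrite rmorphXn /= normcE_norm sqr_normc. Qed.

Lemma normc_real (r : R) : normc (r%:C) = `|r|.
Proof. by rewrite /= expr0n addr0 sqrtr_sqr. Qed.

Lemma normr_Re_le (x : C) : `|complex.Re x| <= normc x.
Proof. by rewrite -lecR normcE_norm normc_ge_Re. Qed.

Lemma le_normc_sum (T : Type) (s : seq T) (P : pred T) (F : T -> C) :
  normc (\sum_(i <- s | P i) F i) <= \sum_(i <- s | P i) normc (F i).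
Proof.
elim/big_ind2: _ => //; first by rewrite normc0.
by move=> x a y b xa yb; apply: le_trans (le_normcD _ _) (lerD xa yb).
Qed.

(** Lagrange's identity: the double sum of [(F i * G j - F j * G i) ^+ 2] is twice the difference of
    the two sides, up to the factor [c ^+ 2]. *)
Lemma cauchy_schwarz (T : finType) (c : R) (F G : T -> R) : 0 <= c ->
  (c * \sum_i F i * G i) ^+ 2 <=
  (c * \sum_i F i ^+ 2) * (c * \sum_i G i ^+ 2).
Proof.
move=> c0; rewrite exprMn [leRHS]mulrACA -[c * c]expr2.
apply: ler_wpM2l; first exact: sqr_ge0.
have : 0 <= \sum_i \sum_j (F i * G j - F j * G i) ^+ 2.
  by apply: sumr_ge0 => i _; apply: sumr_ge0 => j _; apply: sqr_ge0.
have -> : \sum_i \sum_j (F i * G j - F j * G i) ^+ 2 =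
   2 * ((\sum_i F i ^+ 2) * (\sum_i G i ^+ 2) - (\sum_i F i * G i) ^+ 2).
  under eq_bigr do under eq_bigr do rewrite sqrrB.
  under eq_bigr do rewrite big_split sumrB /=.
  rewrite big_split sumrB /=.
  have -> : \sum_i \sum_j (F i * G j) ^+ 2 = (\sum_i F i ^+ 2) * (\sum_i G i ^+ 2).
    rewrite big_distrlr /=; apply: eq_bigr => i _; apply: eq_bigr => j _.
    by rewrite exprMn.
  have -> : \sum_i \sum_j (F j * G i) ^+ 2 = (\sum_i F i ^+ 2) * (\sum_i G i ^+ 2).
    rewrite exchange_big big_distrlr /=.
    by apply: eq_bigr => i _; apply: eq_bigr => j _; rewrite exprMn.
  have -> : \sum_i \sum_j F i * G j * (F j * G i) *+ 2 = 2 * (\sum_i F i * G i) ^+ 2.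
    rewrite expr2 big_distrlr /= mulr_sumr; apply: eq_bigr => i _.
    rewrite mulr_sumr; apply: eq_bigr => j _; ring.
  ring.
by rewrite pmulr_rge0 ?ltr0n // subr_ge0.
Qed.

Definition avgr (T : finType) (F : T -> R) : R := (#|T|%:R)^-1 * \sum_t F t.

Lemma invn_ge0 n : 0 <= (n%:R)^-1 :> R.
Proof. by rewrite invr_ge0 ler0n. Qed.

Section Averages.
Variable T : finType.
Implicit Types (F G : T -> C) (f g : T -> R).

Lemma eq_avg F G : F =1 G -> avg F = avg G.
Proof. by move=> FG; rewrite /avg (eq_bigr _ (fun i _ => FG i)). Qed.

Lemma eq_avgr f g : f =1 g -> avgr f = avgr g.
Proof. by move=> FG; rewrite /avgr (eq_bigr _ (fun i _ => FG i)). Qed.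

Lemma avgD F G : avg (fun x => F x + G x) = avg F + avg G.
Proof. by rewrite /avg big_split mulrDr. Qed.

Lemma avgB F G : avg (fun x => F x - G x) = avg F - avg G.
Proof. by rewrite /avg sumrB mulrBr. Qed.

Lemma avgMl a F : avg (fun x => a * F x) = a * avg F.
Proof. by rewrite /avg -mulr_sumr mulrCA. Qed.

Lemma avgMr a F : avg (fun x => F x * a) = avg F * a.
Proof. by rewrite /avg -mulr_suml mulrA. Qed.

Lemma avg_sum (I : finType) (P : pred I) (F : I -> T -> C) :
  avg (fun x => \sum_(i | P i) F i x) = \sum_(i | P i) avg (F i).
Proof. by rewrite /avg exchange_big mulr_sumr. Qed.

Lemma avg_conj F : (avg F)^* = avg (fun x => (F x)^*).
Proof. by rewrite /avg rmorphM fmorphV rmorph_nat rmorph_sum. Qed.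

Lemma avg_real f : avg (fun x => (f x)%:C) = (avgr f)%:C.
Proof. by rewrite /avg /avgr rmorphM fmorphV rmorph_nat rmorph_sum. Qed.

Lemma avgrD f g : avgr (fun x => f x + g x) = avgr f + avgr g.
Proof. by rewrite /avgr big_split mulrDr. Qed.

Lemma avgrMl a f : avgr (fun x => a * f x) = a * avgr f.
Proof. by rewrite /avgr -mulr_sumr mulrCA. Qed.

Lemma avgrMr a f : avgr (fun x => f x * a) = avgr f * a.
Proof. by rewrite /avgr -mulr_suml mulrA. Qed.

Lemma avgr_sum (I : finType) (P : pred I) (F : I -> T -> R) :
  avgr (fun x => \sum_(i | P i) F i x) = \sum_(i | P i) avgr (F i).
Proof. by rewrite /avgr exchange_big mulr_sumr. Qed.

Lemma avgr_ge0 f : (forall x, 0 <= f x) -> 0 <= avgr f.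
Proof. by move=> f0; rewrite mulr_ge0 ?invn_ge0 // sumr_ge0. Qed.

Lemma ler_avgr f g : (forall x, f x <= g x) -> avgr f <= avgr g.
Proof. by move=> fg; rewrite ler_wpM2l ?invn_ge0 // ler_sum. Qed.

Lemma le_normc_avg F : normc (avg F) <= avgr (fun x => normc (F x)).
Proof.
rewrite /avg /avgr normcM; apply: ler_pM; rewrite ?normc_ge0 ?le_normc_sum //.
by rewrite normcV -(rmorph_nat (real_complex R)) normc_real ger0_norm ?ler0n.
Qed.

Lemma reindex_avg (h : T -> T) F : bijective h -> avg F = avg (fun x => F (h x)).
Proof. by move=> hb; rewrite /avg (reindex h) //; apply: onW_bij. Qed.

Lemma reindex_avgr (h : T -> T) f : bijective h -> avgr f = avgr (fun x => f (h x)).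
Proof. by move=> hb; rewrite /avgr (reindex h) //; apply: onW_bij. Qed.

Lemma avgr_cs f g : avgr (fun x => f x * g x) ^+ 2 <=
  avgr (fun x => f x ^+ 2) * avgr (fun x => g x ^+ 2).
Proof. by apply: cauchy_schwarz; rewrite invn_ge0. Qed.

End Averages.

Lemma exchange_avg (T T' : finType) (F : T -> T' -> C) :
  avg (fun x => avg (F x)) = avg (fun y => avg (fun x => F x y)).
Proof.
rewrite /avg; under eq_bigr do rewrite mulr_sumr.
rewrite exchange_big /= !mulr_sumr; apply: eq_bigr => y _.
by rewrite !mulr_sumr; apply: eq_bigr => x _; rewrite mulrCA.
Qed.

Lemma exchange_avgr (T T' : finType) (F : T -> T' -> R) :
  avgr (fun x => avgr (F x)) = avgr (fun y => avgr (fun x => F x y)).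
Proof.
rewrite /avgr; under eq_bigr do rewrite mulr_sumr.
rewrite exchange_big /= !mulr_sumr; apply: eq_bigr => y _.
by rewrite !mulr_sumr; apply: eq_bigr => x _; rewrite mulrCA.
Qed.

Lemma pair_avg (T T' : finType) (F : T * T' -> C) :
  avg F = avg (fun x => avg (fun y => F (x, y))).
Proof.
rewrite /avg card_prod natrM invfM -mulrA; congr (_ * _).
rewrite -mulr_sumr; congr (_ * _); rewrite pair_bigA /=.
by apply: eq_bigr => -[].
Qed.

(** * The Hilbert space of functions on the group, and orthonormal bases *)

Section Hilbert.
Variable Z : finZmodType.
Implicit Types (f g h : Z -> C).

Lemma card_Z_neq0 : (#|Z|%:R : R) != 0.
Proof. by rewrite pnatr_eq0 -lt0n; apply/card_gt0P; exists 0. Qed.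

Lemma card_ZC_neq0 : (#|Z|%:R : C) != 0.
Proof. by rewrite pnatr_eq0 -lt0n; apply/card_gt0P; exists 0. Qed.

Lemma avgr_cst (a : R) : avgr (fun _ : Z => a) = a.
Proof.
by rewrite /avgr sumr_const -[a *+ _]mulr_natl mulrA mulVf ?mul1r // card_Z_neq0.
Qed.

Lemma shift_avg (a : Z) (F : Z -> C) : avg F = avg (fun x => F (x + a)).
Proof. by apply: reindex_avg; exists (fun x => x - a) => x; rewrite ?addrK ?subrK. Qed.

Lemma shift_avgr (a : Z) (F : Z -> R) : avgr F = avgr (fun x => F (x + a)).
Proof. by apply: reindex_avgr; exists (fun x => x - a) => x; rewrite ?addrK ?subrK. Qed.

Lemma opp_avgr (F : Z -> R) : avgr F = avgr (fun x => F (- x)).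
Proof. by apply: reindex_avgr; exists -%R; exact: opprK. Qed.

(* The square of [norm2]. *)
Definition sqn f : R := avgr (fun x => normc (f x) ^+ 2).

Lemma sqn_ge0 f : 0 <= sqn f.
Proof. by apply: avgr_ge0 => x; apply: sqr_ge0. Qed.

Lemma innerxx f : inner f f = (sqn f)%:C.
Proof. by rewrite -avg_real; apply: eq_avg => x; rewrite normc_sqr. Qed.

Lemma eq_inner f f' g g' : f =1 f' -> g =1 g' -> inner f g = inner f' g'.
Proof. by move=> ff gg; apply: eq_avg => x; rewrite ff gg. Qed.

Lemma innerC f g : inner g f = (inner f g)^*.
Proof. by rewrite avg_conj; apply: eq_avg => x; rewrite rmorphM /= conjCK mulrC. Qed.

Lemma innerDl f g h : inner (fun x => f x + g x) h = inner f h + inner g h.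
Proof. by rewrite -avgD; apply: eq_avg => x; rewrite mulrDl. Qed.

Lemma innerBl f g h : inner (fun x => f x - g x) h = inner f h - inner g h.
Proof. by rewrite -avgB; apply: eq_avg => x; rewrite mulrBl. Qed.

Lemma innerZl a f g : inner (fun x => a * f x) g = a * inner f g.
Proof. by rewrite -avgMl; apply: eq_avg => x; rewrite mulrA. Qed.

Lemma inner_suml (I : finType) (P : pred I) (F : I -> Z -> C) g :
  inner (fun x => \sum_(i | P i) F i x) g = \sum_(i | P i) inner (F i) g.
Proof. by rewrite -avg_sum; apply: eq_avg => x; rewrite mulr_suml. Qed.

Lemma innerZr a f g : inner f (fun x => a * g x) = a^* * inner f g.
Proof. by rewrite innerC innerZl rmorphM /= -innerC. Qed.

Lemma innerDr f g h : inner h (fun x => f x + g x) = inner h f + inner h g.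
Proof. by rewrite innerC innerDl rmorphD /= -!innerC. Qed.

Lemma inner_sumr (I : finType) (P : pred I) (F : I -> Z -> C) g :
  inner g (fun x => \sum_(i | P i) F i x) = \sum_(i | P i) inner g (F i).
Proof.
by rewrite innerC inner_suml rmorph_sum /=; apply: eq_bigr => i _; rewrite -innerC.
Qed.

Lemma inner_cs f g : normc (inner f g) ^+ 2 <= sqn f * sqn g.
Proof.
apply: le_trans (avgr_cs _ _).
rewrite ler_sqr ?nnegrE ?normc_ge0 //; last first.
  by apply: avgr_ge0 => x; rewrite mulr_ge0 ?normc_ge0.
apply: le_trans (le_normc_avg _) _; apply: ler_avgr => x.
by rewrite normcM normc_conj.
Qed.

Lemma normc_inner_le f g (a b : R) : 0 <= a -> 0 <= b ->
  sqn f <= a ^+ 2 -> sqn g <= b ^+ 2 -> normc (inner f g) <= a * b.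
Proof.
move=> a0 b0 fa gb; rewrite -ler_sqr ?nnegrE ?normc_ge0 ?mulr_ge0 //.
by rewrite (le_trans (inner_cs _ _)) // exprMn ler_pM ?sqn_ge0.
Qed.

Lemma sqnZ a f : sqn (fun x => a * f x) = normc a ^+ 2 * sqn f.
Proof. by rewrite -avgrMl; apply: eq_avgr => x; rewrite normcM exprMn. Qed.

Lemma eq_sqn f g : f =1 g -> sqn f = sqn g.
Proof. by move=> fg; apply: eq_avgr => x; rewrite fg. Qed.

Definition onb (I : finType) (e : I -> Z -> C) : Prop :=
  (forall i j, inner (e i) (e j) = (i == j)%:R) /\
  (forall f x, f x = \sum_i inner f (e i) * e i x).

Lemma parseval (I : finType) (e : I -> Z -> C) f g : onb e ->
  inner f g = \sum_i inner f (e i) * (inner g (e i))^*.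
Proof.
move=> [_ co]; rewrite (eq_inner (co f) (frefl g)) inner_suml.
by apply: eq_bigr => i _; rewrite innerZl [inner (e i) _]innerC.
Qed.

Lemma parseval_sqn (I : finType) (e : I -> Z -> C) f : onb e ->
  sqn f = \sum_i normc (inner f (e i)) ^+ 2.
Proof.
move=> eo; apply: (@complexI R); rewrite -innerxx (parseval _ _ eo) rmorph_sum.
by apply: eq_bigr => i _; rewrite -normc_sqr.
Qed.

Lemma sum_enum_val (V : nmodType) (F : Z -> V) :
  \sum_x F x = \sum_(k < #|Z|) F (enum_val k).
Proof. by rewrite (reindex _ (onW_bij _ (@enum_val_bij Z))). Qed.

(** Orthonormality says [P *m Q = 1]; for square matrices [Q *m P = 1] follows, which is
    completeness. *)
Lemma onb_of_card n (e : 'I_n -> Z -> C) : n = #|Z| ->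
  (forall i j, inner (e i) (e j) = (i == j)%:R) -> onb e.
Proof.
move=> En eo; split=> // f x; subst n.
pose P : 'M[C]_#|Z| := \matrix_(i, k) e i (enum_val k).
pose Q : 'M[C]_#|Z| := \matrix_(k, j) ((#|Z|%:R)^-1 * (e j (enum_val k))^*).
have PQ : P *m Q = 1%:M.
  apply/matrixP => i j; rewrite !mxE -eo /inner /avg.
  rewrite sum_enum_val mulr_sumr.
  by apply: eq_bigr => k _; rewrite !mxE mulrCA.
have QP z : \sum_i (#|Z|%:R)^-1 * (e i z)^* * e i x = (z == x)%:R.
  have /matrixP/(_ (enum_rank z) (enum_rank x)) := mulmx1C PQ.
  rewrite !mxE (inj_eq enum_rank_inj) => <-.
  by apply: eq_bigr => i _; rewrite !mxE !enum_rankK.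
transitivity (\sum_z f z * (z == x)%:R).
  rewrite (bigD1 x) //= eqxx mulr1 big1 ?addr0 // => z /negbTE ->.
  by rewrite mulr0.
under eq_bigr do rewrite -QP mulr_sumr.
rewrite exchange_big /=; apply: eq_bigr => i _.
rewrite /inner /avg -mulrA mulr_suml mulr_sumr; apply: eq_bigr => z _.
ring.
Qed.

End Hilbert.
End Basics.

(** * Eigenbases and characters *)

Section Bases.
Import ComplexField.Normc.
Variable R : realType.
Local Notation C := (complex R).
Local Notation "x %:C" := (real_complex R x) : ring_scope.
Variable Z : finZmodType.

Definition app (M : Z -> Z -> C) (v : Z -> C) : Z -> C :=
  fun x => avg (fun y => M x y * v y).

Definition hermitian_kernel (M : Z -> Z -> C) : Prop :=
  forall x y, M y x = (M x y)^*.

Lemma spectral_kernel (A : Z -> Z -> C) : hermitian_kernel A ->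
  exists (e : 'I_#|Z| -> Z -> C) (lam : 'I_#|Z| -> R),
    onb e /\ forall i, app A (e i) =1 (fun x => (lam i)%:C * e i x).
Proof.
move=> hA; set N := #|Z|.
(* The kernel is transposed because row [i] of the spectral matrix [P], acting from the left, is to
   become the eigenvector [e i]. *)
pose M : 'M[C]_N := \matrix_(k, l) (N%:R^-1 * A (enum_val l) (enum_val k)).
have hM : M \is hermsymmx.
  apply/is_hermitianmxP; rewrite expr0 scale1r; apply/matrixP => k l.
  rewrite !mxE hA rmorphM fmorphV rmorph_nat; congr (_ * _).
have /hermitian_spectral_diag_real dR := hM.
have := hermitian_normalmx hM => /orthomx_spectralP Meq.
have uP := spectral_unitarymx M; have iP := spectral_unit M.
set P := spectralmx M in Meq uP iP; set d := spectral_diag M in Meq dR.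
have PM : P *m M = diag_mx d *m P.
  by rewrite {1}Meq !mulmxA mulmxV // mul1mx.
have N0 : (0 : R) <= N%:R by rewrite ler0n.
(* The factor [s] turns unit vectors for the plain inner product into unit vectors for the averaged
   one. *)
pose s : C := (Num.sqrt N%:R)%:C.
have ss : s * s^* = N%:R.
  by rewrite /s conjC_real -rmorphM -expr2 sqr_sqrtr // (rmorph_nat (real_complex R)).
pose e (i : 'I_#|Z|) (z : Z) : C := s * P i (enum_rank z).
pose lam (i : 'I_#|Z|) : R := complex.Re (d 0 i).
exists e. exists lam.
split.
  apply: onb_of_card => // i j.
  have /matrixP/(_ i j) := unitarymxP uP; rewrite !mxE => <-.
  rewrite /inner /avg sum_enum_val mulr_sumr; apply: eq_bigr => k _.
  rewrite !mxE /e !enum_valK rmorphM /= mulrACA ss !mulrA mulVf ?mul1r //.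
  exact: card_ZC_neq0.
move=> i x.
have /matrixP/(_ i (enum_rank x)) := PM; rewrite mul_diag_mx !mxE => E.
have -> : (complex.Re (d 0 i))%:C = d 0 i by apply: RRe_real; exact: (mxOverP dR).
rewrite /e mulrCA -E /app /avg sum_enum_val mulr_sumr mulr_sumr; apply: eq_bigr => k _.
rewrite !mxE !enum_rankK enum_valK; ring.
Qed.

Lemma dual_group0 (chi : Z -> C) : dual_group chi -> chi 0 = 1.
Proof.
move=> [c1 cM]; have := cM 0 0; rewrite addr0 => /eqP.
rewrite -[X in X == _]mulr1 (inj_eq (mulfI _)) => [/eqP //|].
by rewrite -normr_gt0 c1.
Qed.

Lemma dual_group_normc (chi : Z -> C) x : dual_group chi -> normc (chi x) = 1.
Proof. by move=> [c1 _]; apply: (@complexI R); rewrite normcE_norm c1. Qed.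

Lemma dual_groupN (chi : Z -> C) x : dual_group chi -> chi (- x) = (chi x)^*.
Proof.
move=> hc; have [c1 cM] := hc.
have nz : chi x != 0 by rewrite -normr_gt0 c1.
apply: (mulfI nz); rewrite -cM subrr dual_group0 // -normc_sqr.
by rewrite dual_group_normc // expr1n.
Qed.

Lemma dual_groupJ (chi : Z -> C) : dual_group chi -> dual_group (fun x => (chi x)^*).
Proof.
by move=> [c1 cM]; split=> [x|x y]; rewrite ?normcJ ?c1 // cM rmorphM.
Qed.

(** Translating by a point [a] where the characters differ multiplies their inner product by
    [chi a * (psi a)^*], which is not 1, so it vanishes. *)
Lemma dual_group_orth (chi psi : Z -> C) : dual_group chi -> dual_group psi ->
  inner chi psi = (chi == psi)%:R.
Proof.
move=> hc hp; case: eqVneq => [<-|ne].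
  rewrite innerxx /sqn (eq_avgr (g := fun=> 1)) ?avgr_cst // => x.
  by rewrite dual_group_normc // expr1n.
have [a Na] : exists a, chi a != psi a.
  apply/existsP; apply: contraNT ne => /existsPn h; apply/eqP/funext => x.
  by have /negPn/eqP := h x.
have [_ cM] := hc; have [_ pM] := hp.
have : inner chi psi * (chi a * (psi a)^*) = inner chi psi * 1.
  rewrite mulr1 -avgMr [RHS]/inner [RHS](shift_avg a); apply: eq_avg => x.
  rewrite cM pM rmorphM /=; ring.
have [E0|nz] := eqVneq (inner chi psi) 0; first by rewrite E0 mulr0n.
move=> /(mulfI nz) E.
case/eqP: Na; have : chi a * (psi a)^* * psi a = psi a by rewrite E mul1r.
by rewrite -mulrA [_^* * _]mulrC -normc_sqr dual_group_normc // expr1n mulr1.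
Qed.

Lemma shift_diagonalizable (a : Z) :
  diagonalizable (\matrix_(k, l) ((enum_val k == enum_val l + a)%:R : C) :
    'M[C]_#|Z|).
Proof.
set M := (X in diagonalizable X).
have uM : M \is unitarymx.
  apply/unitarymxP/matrixP => k l; rewrite !mxE.
  rewrite (bigD1 (enum_rank (enum_val k - a))) //= big1 ?addr0.
    rewrite !mxE !enum_rankK subrK eqxx mul1r conjC_nat.
    by rewrite eq_sym (inj_eq enum_val_inj).
  move=> i ni; rewrite !mxE; case: eqP => [E|]; last by rewrite mul0r.
  by case/eqP: ni; rewrite E addrK enum_valK.
have nM : M \is normalmx.
  by apply/normalmxP; rewrite (unitarymxP uM) (mulmx1C (unitarymxP uM)).
have Meq := orthomx_spectralP nM; have iP := spectral_unit M.
exists (spectralmx M) => //; apply/(diagonalizable_forP _ iP) => i j ij.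
rewrite {2}Meq !mulmxA mulmxV // mul1mx -mulmxA mulmxV // mulmx1.
by rewrite mxE -val_eqE (negbTE ij) mulr0n.
Qed.

(* The translations form a commuting family of unitary, hence diagonalizable,
   matrices; a common eigenvector is a multiple of a character. *)
Lemma dual_group_onb : exists2 ch : 'I_#|Z| -> Z -> C, onb ch &
  injective ch /\ (forall chi, dual_group chi <-> exists i, chi = ch i).
Proof.
pose T (a : Z) : 'M[C]_#|Z| :=
  \matrix_(k, l) ((enum_val k == enum_val l + a)%:R : C).
have TE (P : 'M[C]_#|Z|) a i l :
    (P *m T a) i l = P i (enum_rank (enum_val l + a)).
  rewrite mxE (bigD1 (enum_rank (enum_val l + a))) //= big1 ?addr0.
    by rewrite mxE enum_rankK eqxx mulr1.
  move=> k nk; rewrite mxE; case: eqP => [E|]; last by rewrite mulr0.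
  by case/eqP: nk; rewrite -E enum_valK.
have [P uP /allP dP] : codiagonalizable [seq T a | a <- enum Z].
  apply/codiagonalizableP; split; last first.
    by move=> _ /mapP[a _ ->]; apply: shift_diagonalizable.
  move=> _ _ /mapP[a _ ->] /mapP[b _ ->]; apply/matrixP => i j.
  by rewrite !TE !mxE !enum_rankK -!addrA [a + b]addrC.
have {dP} [d dP] : exists d : Z -> 'I_#|Z| -> C, forall a i x,
    P i (enum_rank (x + a)) = d a i * P i (enum_rank x).
  have h a : exists da : 'I_#|Z| -> C, forall i x,
      P i (enum_rank (x + a)) = da i * P i (enum_rank x).
    have := dP (T a); rewrite map_f ?mem_enum // => /(_ isT).
    move=> /diagonalizable_forPex[D /(simmxP uP) E]; exists (D 0) => i x.
    have /matrixP/(_ i (enum_rank x)) := E.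
    by rewrite TE mul_diag_mx !mxE !enum_rankK.
  have [d dd] := choice h; by exists d.
pose r := @enum_rank Z.
(* A row vanishing at 0 would vanish everywhere, against the invertibility of [P]. Division by the
   value at 0 then makes each row multiplicative. *)
have P0 i : P i (r 0) != 0.
  apply/eqP => P0; have : row i P = 0.
    apply/rowP => k; rewrite !mxE -[k]enum_valK -[enum_val k]add0r dP.
    by rewrite P0 mulr0.
  move/eqP: (row_free_unit P); rewrite uP => /eqP rf.
  move=> R0; have /row_freeP[B PB] : row_free P by rewrite row_free_unit.
  have /matrixP/(_ i i) := PB; rewrite mxE big1 => [|k _]; last first.
    by have /rowP/(_ k) := R0; rewrite !mxE => ->; rewrite mul0r.
  by rewrite mxE eqxx => /esym/eqP; rewrite oner_eq0.
pose ch i x := P i (r x) / P i (r 0).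
have chM i : {morph ch i : x y / x + y >-> x * y}.
  move=> x y; rewrite /ch dP.
  have -> : P i (r y) = d y i * P i (r 0) by rewrite -dP add0r.
  rewrite (mulfK (P0 i)) /r; ring.
have ch0 i : ch i 0 = 1 by rewrite /ch divff.
have chX i x n : ch i (x *+ n) = ch i x ^+ n.
  by elim: n => [|n IHn]; rewrite ?ch0 // mulrS chM IHn exprS.
have chN (x : Z) : x *+ #|Z| = 0.
  have : \sum_(y : Z) y = \sum_(y : Z) (x + y) by apply: reindex_inj; exact: addrI.
  by rewrite big_split /= sumr_const -[LHS]add0r => /addIr/esym.
(* Every element is killed by [#|Z|], so the values of [ch i] are roots of unity. *)
have chD i : dual_group (ch i).
  split=> // x; have := chX i x #|Z|; rewrite chN // ch0 => /(congr1 Num.norm).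
  rewrite normr1 normrX => /esym/eqP; rewrite pexpr_eq1 ?normr_ge0 //.
    by move/eqP.
  by apply/card_gt0P; exists 0.
have chI : injective ch.
  move=> i j E; apply/eqP/negP => /negP nij.
  have /matrixP/(_ i i) := mulmxV uP; have /matrixP/(_ j i) := mulmxV uP.
  rewrite !mxE eqxx eq_sym (negbTE nij) => Ej Ei.
  have : P i (r 0) * \sum_k P j k * invmx P k i =
         P j (r 0) * \sum_k P i k * invmx P k i.
    rewrite !mulr_sumr; apply: eq_bigr => k _; rewrite !mulrA; congr (_ * _).
    have := congr1 (fun g => g (enum_val k)) E; rewrite /ch /r enum_valK => Ek.
    have -> : P i k = ch i (enum_val k) * P i (r 0) by rewrite divfK // /r enum_valK.
    have -> : P j k = ch j (enum_val k) * P j (r 0) by rewrite divfK // /r enum_valK.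
    rewrite E; ring.
  by rewrite Ei Ej mulr0 mulr1 => /esym/eqP; rewrite (negbTE (P0 j)).
have cho i j : inner (ch i) (ch j) = (i == j)%:R.
  by rewrite dual_group_orth // (inj_eq chI).
have ob : onb ch by exact: onb_of_card.
exists ch => //; split=> // chi; split=> [hc|[i ->//]].
have [i nz] : exists i, inner chi (ch i) != 0.
  apply/existsP; apply: contraT => /existsPn h.
  have := dual_group0 hc; rewrite (ob.2 chi 0) big1 => [/esym/eqP|i _].
    by rewrite oner_eq0.
  by have /negPn/eqP -> := h i; rewrite mul0r.
exists i; apply/eqP; move: nz; rewrite dual_group_orth //.
by case: (chi == ch i) => //=; rewrite mulr0n eqxx.
Qed.

End Bases.

(** * Fourier coefficients of diagonals and the third Gowers norm *)

Section Fourier.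
Import ComplexField.Normc.
Variable R : realType.
Local Notation C := (complex R).
Local Notation "x %:C" := (real_complex R x) : ring_scope.
Variable Z : finZmodType.
Local Notation diagonal := Defs.diagonal.
Local Notation K := 'I_#|Z|.
Implicit Types (f g h v w : Z -> C) (M N : Z -> Z -> C).

(* The sum over the Heisenberg group modulo its centre, normalized as the average
   over translations of the sum over characters. *)
Definition dsum (F : Z -> K -> R) : R := avgr (fun t => \sum_k F t k).

Lemma dsumE F : dsum F = (#|Z|%:R)^-1 * \sum_(p : Z * K) F p.1 p.2.
Proof. by rewrite /dsum /avgr (pair_bigA _ F). Qed.

Lemma eq_dsum F G : (forall t k, F t k = G t k) -> dsum F = dsum G.
Proof. by move=> FG; apply: eq_avgr => t; apply: eq_bigr => k _. Qed.

Lemma dsumD F G : dsum (fun t k => F t k + G t k) = dsum F + dsum G.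
Proof. by rewrite /dsum -avgrD; apply: eq_avgr => t; rewrite big_split. Qed.

Lemma dsumMl a F : dsum (fun t k => a * F t k) = a * dsum F.
Proof. by rewrite /dsum -avgrMl; apply: eq_avgr => t; rewrite mulr_sumr. Qed.

Lemma dsum_ge0 F : (forall t k, 0 <= F t k) -> 0 <= dsum F.
Proof. by move=> F0; apply: avgr_ge0 => t; apply: sumr_ge0. Qed.

Lemma ler_dsum F G : (forall t k, F t k <= G t k) -> dsum F <= dsum G.
Proof. by move=> FG; apply: ler_avgr => t; apply: ler_sum. Qed.

Lemma dsum_cs F G : dsum (fun t k => F t k * G t k) ^+ 2 <=
  dsum (fun t k => F t k ^+ 2) * dsum (fun t k => G t k ^+ 2).
Proof. by rewrite !dsumE; apply: cauchy_schwarz; rewrite invn_ge0. Qed.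

Lemma normc_dsum (F : Z -> K -> C) :
  normc (avg (fun t => \sum_k F t k)) <= dsum (fun t k => normc (F t k)).
Proof.
apply: le_trans (le_normc_avg _) _; apply: ler_avgr => t; exact: le_normc_sum.
Qed.

(* The normalized Hilbert-Schmidt inner product and squared norm. *)
Definition hs M N : C := avg (fun x => avg (fun y => M x y * (N x y)^*)).
Definition hs2 M : R := avgr (fun x => avgr (fun y => normc (M x y) ^+ 2)).

Lemma hsxx M : hs M M = (hs2 M)%:C.
Proof.
rewrite -avg_real; apply: eq_avg => x; rewrite -avg_real; apply: eq_avg => y.
by rewrite normc_sqr.
Qed.

Lemma avg_diag (F : Z -> Z -> C) :
  avg (fun x => avg (F x)) = avg (fun t => avg (fun z => F (z + t) z)).
Proof.
rewrite exchange_avg [RHS]exchange_avg; apply: eq_avg => z.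
by rewrite (shift_avg z); apply: eq_avg => t; rewrite addrC.
Qed.

Lemma avgr_diag (F : Z -> Z -> R) :
  avgr (fun x => avgr (F x)) = avgr (fun t => avgr (fun z => F (z + t) z)).
Proof.
rewrite exchange_avgr [RHS]exchange_avgr; apply: eq_avgr => z.
by rewrite (shift_avgr z); apply: eq_avgr => t; rewrite addrC.
Qed.

Variable ch : K -> Z -> C.
Hypothesis ch_onb : onb ch.
Hypothesis chD : forall k, dual_group (ch k).

Definition coef M t k : C := inner (diagonal M t) (ch k).

Lemma hs_coef M N :
  hs M N = avg (fun t => \sum_k coef M t k * (coef N t k)^*).
Proof.
rewrite /hs avg_diag; apply: eq_avg => t.
by rewrite -(parseval _ _ ch_onb).
Qed.

Lemma hs2_coef M : hs2 M = dsum (fun t k => normc (coef M t k) ^+ 2).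
Proof.
by rewrite /hs2 avgr_diag; apply: eq_avgr => t; rewrite -(parseval_sqn _ ch_onb).
Qed.

Lemma normc_hs_le M N :
  normc (hs M N) <= dsum (fun t k => normc (coef M t k) * normc (coef N t k)).
Proof.
rewrite hs_coef; apply: le_trans (normc_dsum _) _; apply: ler_dsum => t k.
by rewrite normcM normc_conj.
Qed.

Lemma hs_cs M N : normc (hs M N) ^+ 2 <= hs2 M * hs2 N.
Proof.
rewrite !hs2_coef; apply: le_trans (dsum_cs _ _).
rewrite ler_sqr ?nnegrE ?normc_ge0 ?normc_hs_le //.
by apply: dsum_ge0 => t k; rewrite mulr_ge0 ?normc_ge0.
Qed.

Definition corr f g : Z -> C := fun t => avg (fun y => f (y + t) * (g y)^*).

(** Convolution theorem: the substitution [t + y] separates the two averages. *)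
Lemma inner_corr f g k :
  inner (corr f g) (ch k) = inner f (ch k) * (inner g (ch k))^*.
Proof.
have [_ cM] := chD k.
rewrite /corr [inner g _]/inner avg_conj -avgMl /inner.
under eq_avg do rewrite -avgMr.
rewrite exchange_avg; apply: eq_avg => y.
rewrite -avgMr [RHS](shift_avg y); apply: eq_avg => t.
rewrite [t + y]addrC cM !rmorphM /= conjCK.
have := normc_sqr (ch k y); rewrite dual_group_normc // expr1n rmorph1 => E.
rewrite -[LHS]mulr1 E. ring.
Qed.

Lemma sqn_corr f g :
  sqn (corr f g) = \sum_k normc (inner f (ch k)) ^+ 2 * normc (inner g (ch k)) ^+ 2.
Proof.
rewrite (parseval_sqn _ ch_onb); apply: eq_bigr => k _.
by rewrite inner_corr normcM normc_conj exprMn.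
Qed.

Lemma sqn_corr_diagonal M N :
  avgr (fun s => sqn (corr (diagonal M s) (diagonal N s))) =
  dsum (fun t k => normc (coef M t k) ^+ 2 * normc (coef N t k) ^+ 2).
Proof. by apply: eq_avgr => s; rewrite sqn_corr. Qed.

Definition tens f g : Z -> Z -> C := fun x y => f x * (g y)^*.

(* Two ways to pair the vertices of a three-dimensional cube. *)
Lemma tens_coef_fourth g w :
  dsum (fun t k => normc (coef (tens g w) t k) ^+ 4) =
  dsum (fun t k => normc (coef (tens g g) t k) ^+ 2 *
                   normc (coef (tens w w) t k) ^+ 2).
Proof.
rewrite -sqn_corr_diagonal.
have -> : dsum (fun t k => normc (coef (tens g w) t k) ^+ 4) =
    dsum (fun t k => normc (coef (tens g w) t k) ^+ 2 *
                     normc (coef (tens g w) t k) ^+ 2).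
  by apply: eq_dsum => t k; rewrite -exprD.
rewrite -sqn_corr_diagonal /sqn exchange_avgr; apply: eq_avgr => s.
apply: eq_avgr => t; congr (normc _ ^+ 2); apply: eq_avg => z.
rewrite /diagonal /tens !rmorphM /= !conjCK addrAC; ring.
Qed.

(** The eighth power of the third Gowers norm, see [gowers3E]. *)
Definition u3 f : R := dsum (fun t k => normc (coef (tens f f) t k) ^+ 4).

Lemma u3_ge0 f : 0 <= u3 f.
Proof. by apply: dsum_ge0 => t k; rewrite exprn_ge0 ?normc_ge0. Qed.

Lemma u3E f : u3 f =
  avgr (fun t => sqn (corr (diagonal (tens f f) t) (diagonal (tens f f) t))).
Proof.
rewrite sqn_corr_diagonal; apply: eq_dsum => t k; by rewrite -exprD.
Qed.

(** Gowers-Cauchy-Schwarz on the cube: re-pairing the vertices separates [g] from [w]. *)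
Lemma tens_coef_fourth_le g w :
  dsum (fun t k => normc (coef (tens g w) t k) ^+ 4) ^+ 2 <= u3 g * u3 w.
Proof.
rewrite tens_coef_fourth; apply: le_trans (dsum_cs _ _) _.
by rewrite /u3 le_eqVlt; apply/orP; left; apply/eqP; congr (_ * _);
  apply: eq_dsum => t k; rewrite -exprM.
Qed.

End Fourier.

(** * The third Gowers norm as a fourth moment of coefficients *)

Section GowersThree.
Import ComplexField.Normc.
Variable R : realType.
Local Notation C := (complex R).
Local Notation "x %:C" := (real_complex R x) : ring_scope.
Variable Z : finZmodType.
Local Notation diagonal := Defs.diagonal.

Definition ffun3 (T : Type) (p : T * T * T) : {ffun 'I_3 -> T} :=
  [ffun i : 'I_3 => nth p.2 [:: p.1.1; p.1.2] i].

Lemma ffun3_bij (T : finType) : bijective (@ffun3 T).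
Proof.
exists (fun u : {ffun 'I_3 -> T} => (u 0, u 1, u (inord 2))).
  by case=> -[a b] c; rewrite !ffunE /= inordK.
move=> u; apply/ffunP => i; rewrite ffunE.
by case: i => -[|[|[|//]]] i /=; congr (u _); apply/val_inj; rewrite //= inordK.
Qed.

Lemma big_ffun3 (S : Type) (idx : S) (op : Monoid.com_law idx) (T : finType)
    (F : {ffun 'I_3 -> T} -> S) :
  \big[op/idx]_u F u =
  \big[op/idx]_a \big[op/idx]_b \big[op/idx]_c F (ffun3 (a, b, c)).
Proof.
rewrite (reindex _ (onW_bij _ (ffun3_bij T))) /=.
rewrite pair_bigA [RHS]pair_bigA /=; apply: eq_bigr => -[[a b] c] _ //.
Qed.

Lemma avg_ffun3 (F : {ffun 'I_3 -> Z} -> C) :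
  avg F = avg (fun a => avg (fun b => avg (fun c => F (ffun3 (a, b, c))))).
Proof.
rewrite /avg card_ffun card_ord big_ffun3.
transitivity ((#|Z|%:R)^-1 * ((#|Z|%:R)^-1 * ((#|Z|%:R)^-1 *
    (\sum_a \sum_b \sum_c F (ffun3 (a, b, c)))))).
  by rewrite natrX -exprVn !exprS expr0 mulr1 -!mulrA.
congr (_ * _); rewrite !mulr_sumr; apply: eq_bigr => a _.
by congr (_ * _); rewrite mulr_sumr.
Qed.

(** For fixed [t1] the rest of the cube average is the fourth power of the U^2 norm of the
    multiplicative derivative [D], that is, the squared L^2 norm of its autocorrelation. *)
Lemma gowers3E (ch : 'I_#|Z| -> Z -> C) (f : Z -> C) : onb ch ->
  (forall k, dual_group (ch k)) -> gowers_norm 3 f = u3 ch f `^ (8^-1).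
Proof.
move=> co cD; rewrite /gowers_norm.
have -> : (2 ^+ 3)^-1 = 8^-1 :> R by congr (_ ^-1); ring.
congr (_ `^ _); rewrite -[u3 ch f]/(complex.Re (real_complex R (u3 ch f))).
congr (complex.Re _); rewrite u3E // -avg_real pair_avg.
under eq_avg do rewrite avg_ffun3.
rewrite exchange_avg; apply: eq_avg => t1; rewrite -avg_real.
set D := diagonal _ _.
pose h b x := D (x + b) * (D x)^*.
transitivity (avg (fun x => avg (fun b => avg (fun c => h b x * (h b (x + c))^*)))).
  apply: eq_avg => x; apply: eq_avg => b; apply: eq_avg => c /=.
  rewrite big_ffun3 !big_bool /=.
  rewrite !big_ord_recl !big_ord0 !ffunE /=.
  rewrite !mulr1n !mulr0n !addr0 !add0r !conjcK /h /D /Defs.diagonal /tens.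
  rewrite -![conjc (f _)]/((f _)^*) !rmorphM /= !conjCK.
  have -> : x + (t1 + (b + c)) = x + c + b + t1 by rewrite !addrA (ACl (1*4*3*2)).
  have -> : x + (t1 + b) = x + b + t1 by rewrite !addrA (ACl (1*3*2)).
  have -> : x + (t1 + c) = x + c + t1 by rewrite !addrA (ACl (1*3*2)).
  have -> : x + (b + c) = x + c + b by rewrite !addrA (ACl (1*3*2)).
  ring.
rewrite exchange_avg; apply: eq_avg => b.
rewrite -[corr D D b]/(avg (h b)) normc_sqr -avgMr; apply: eq_avg => x.
rewrite avgMl; congr (_ * _); rewrite avg_conj [RHS](shift_avg x).
by apply: eq_avg => c; rewrite addrC.
Qed.

End GowersThree.

(** * Weyl operators *)

Section Weyl.
Import ComplexField.Normc.
Variable R : realType.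
Local Notation C := (complex R).
Local Notation "x %:C" := (real_complex R x) : ring_scope.
Variable Z : finZmodType.
Local Notation diagonal := Defs.diagonal.
Local Notation K := 'I_#|Z|.
Implicit Types (f g h v w : Z -> C) (M N : Z -> Z -> C).

Lemma inner_app_hs M v w : inner (app M v) w = hs M (tens w v).
Proof.
apply: eq_avg => x; rewrite -avgMr; apply: eq_avg => y.
by rewrite rmorphM /= conjCK; ring.
Qed.

Lemma hs2_tens v w : hs2 (tens v w) = sqn v * sqn w.
Proof.
rewrite /sqn -avgrMr; apply: eq_avgr => x; rewrite -avgrMl; apply: eq_avgr => y.
by rewrite normcM normc_conj exprMn.
Qed.

Lemma hs2_ge0 M : 0 <= hs2 M.
Proof. by apply: avgr_ge0 => x; apply: avgr_ge0 => y; rewrite sqr_ge0. Qed.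

Lemma sqn_app_le M v : sqn (app M v) <= hs2 M * sqn v.
Proof.
rewrite /sqn -avgrMr; apply: ler_avgr => x.
have -> : app M v x = inner (M x) (fun y => (v y)^*).
  by apply: eq_avg => y; rewrite conjCK.
apply: le_trans (inner_cs _ _) _; rewrite le_eqVlt; apply/orP; left; apply/eqP.
by congr (_ * _); apply: eq_avgr => y; rewrite normc_conj.
Qed.

Definition selfadjoint (S : (Z -> C) -> Z -> C) : Prop :=
  forall v w, inner (S v) w = inner v (S w).

Lemma hermitian_selfadjoint M : hermitian_kernel M -> selfadjoint (app M).
Proof.
move=> hM v w; rewrite inner_app_hs innerC inner_app_hs /hs exchange_avg avg_conj.
apply: eq_avg => x; rewrite avg_conj; apply: eq_avg => y.
by rewrite (hM y x) /tens !rmorphM /= !conjCK; ring.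
Qed.

Definition quad M v : C := inner (app M v) v.

Lemma quad_hs M v : quad M v = hs M (tens v v).
Proof. exact: inner_app_hs. Qed.

Lemma quad_tens f v : quad (tens f f) v = (normc (inner f v) ^+ 2)%:C.
Proof.
rewrite normc_sqr -innerC /quad mulrC -innerZl; apply: eq_inner => // x.
by rewrite /app /inner -avgMr; apply: eq_avg => y; rewrite /tens; ring.
Qed.

Lemma normc_quad_le (ch : K -> Z -> C) (co : onb ch) M v (d c : R) :
  0 <= d -> hs2 M <= d ^+ 2 -> sqn v <= c -> normc (quad M v) <= d * c.
Proof.
move=> d0 hd vc; have c0 := le_trans (sqn_ge0 v) vc.
rewrite -ler_sqr ?nnegrE ?normc_ge0 ?mulr_ge0 // quad_hs.
apply: le_trans (hs_cs co _ _) _.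
rewrite hs2_tens exprMn [c ^+ 2]expr2.
apply: ler_pM => //; rewrite ?hs2_ge0 1?mulr_ge0 ?sqn_ge0 //.
by apply: ler_pM; rewrite ?sqn_ge0.
Qed.

Variable ch : K -> Z -> C.
Hypothesis ch_onb : onb ch.
Hypothesis chD : forall k, dual_group (ch k).

(* [coef ch (tens f f) t k] is the matrix coefficient [inner f (weyl t k f)]. *)
Definition weyl t k f : Z -> C := fun x => ch k (x - t) * f (x - t).
Definition weyl_adj t k f : Z -> C := fun x => (ch k x)^* * f (x + t).

Lemma inner_weyl t k f g : inner (weyl_adj t k f) g = inner f (weyl t k g).
Proof.
rewrite [RHS](shift_avg t); apply: eq_avg => x.
by rewrite /weyl addrK rmorphM /weyl_adj /=; ring.
Qed.

Lemma sqn_weyl t k f : sqn (weyl t k f) = sqn f.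
Proof.
rewrite /sqn (shift_avgr t); apply: eq_avgr => x.
by rewrite /weyl addrK normcM dual_group_normc // mul1r.
Qed.

Lemma sqn_weyl_adj t k f : sqn (weyl_adj t k f) = sqn f.
Proof.
rewrite [RHS]/sqn (shift_avgr t); apply: eq_avgr => x.
by rewrite /weyl_adj normcM normc_conj dual_group_normc // mul1r.
Qed.

Lemma coef_tens f g t k : coef ch (tens f g) t k = inner f (weyl t k g).
Proof.
rewrite [RHS](shift_avg t); apply: eq_avg => x.
by rewrite /weyl addrK rmorphM /Defs.diagonal /tens /=; ring.
Qed.

Lemma normc_coef_tens_le1 f t k : sqn f <= 1 -> normc (coef ch (tens f f) t k) <= 1.
Proof.
move=> f1; rewrite coef_tens -[1]mulr1; apply: normc_inner_le; rewrite ?ler01 ?expr1n //.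
by rewrite sqn_weyl.
Qed.

Lemma dsum_coef_tens_le1 f : sqn f <= 1 ->
  dsum (fun t k => normc (coef ch (tens f f) t k) ^+ 2) <= 1.
Proof. by move=> f1; rewrite -(hs2_coef ch_onb) hs2_tens mulr_ile1 ?sqn_ge0. Qed.

(** The sense in which the pseudorandom part is small, although its Hilbert-Schmidt norm need not
    be. *)
Definition sbound M (c : R) : Prop := forall t k, normc (coef ch M t k) <= c.

Lemma corr_sbound M N (c : R) : sbound M c ->
  avgr (fun s => sqn (corr (diagonal M s) (diagonal N s))) <= c ^+ 2 * hs2 N.
Proof.
move=> Mc; rewrite (sqn_corr_diagonal ch_onb chD) (hs2_coef ch_onb) -dsumMl.
apply: ler_dsum => t k; apply: ler_wpM2r; first exact: sqr_ge0.
by rewrite ler_sqr ?nnegrE ?normc_ge0 // (le_trans _ (Mc t k)) ?normc_ge0.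
Qed.

Lemma ch_sub k x y : ch k (x - y) = ch k x * (ch k y)^*.
Proof. by have [_ ->] := chD k; rewrite dual_groupN. Qed.

(* Conjugating by the Weyl operators only modulates the coefficients of [M], so
   summing over all of them is a Plancherel identity. *)
Lemma weyl_conj_sbound M N (c : R) : sbound M c ->
  dsum (fun t k => normc (avg (fun x => avg (fun y =>
    M (x + t) (y + t) * (ch k (x - y))^* * (N x y)^*))) ^+ 2) <= c ^+ 2 * hs2 N.
Proof.
move=> Mc; apply: le_trans _ (corr_sbound N Mc).
rewrite /sqn exchange_avgr le_eqVlt; apply/orP; left; apply/eqP.
apply: eq_avgr => t.
pose c_ s := corr (diagonal M s) (diagonal N s) t.
transitivity (sqn c_); last by [].
rewrite (parseval_sqn _ ch_onb); apply: eq_bigr => k _; congr (normc _ ^+ 2).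
rewrite avg_diag; apply: eq_avg => s; rewrite /c_ /corr -avgMr; apply: eq_avg => z.
have -> : z + s - z = s by rewrite addrAC subrr add0r.
rewrite /Defs.diagonal [z + _ + s]addrAC; ring.
Qed.

(** Plancherel as in [weyl_conj_sbound], after reflecting [t] and conjugating, which leaves the
    moduli unchanged. *)
Lemma weyl_adj_conj_sbound M N (c : R) : sbound M c ->
  dsum (fun t k => normc (avg (fun x => avg (fun y =>
    M (x - t) (y - t) * ch k (x - y) * (N x y)^*))) ^+ 2) <= c ^+ 2 * hs2 N.
Proof.
move=> Mc; apply: le_trans _ (corr_sbound N Mc).
rewrite /sqn exchange_avgr le_eqVlt; apply/orP; left; apply/eqP.
rewrite [RHS]opp_avgr; apply: eq_avgr => t.
pose c_ s := (corr (diagonal M s) (diagonal N s) (- t))^*.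
transitivity (sqn c_); last by apply: eq_avgr => s; rewrite normc_conj.
rewrite (parseval_sqn _ ch_onb); apply: eq_bigr => k _.
rewrite -[in RHS]normc_conj; congr (normc _ ^+ 2).
rewrite avg_diag /inner avg_conj; apply: eq_avg => s.
rewrite /c_ /corr rmorphM /= !conjCK -avgMr; apply: eq_avg => z.
have -> : z + s - z = s by rewrite addrAC subrr add0r.
rewrite /Defs.diagonal [z + _ + s]addrAC; ring.
Qed.

(** Moving the Weyl operators from [f] onto [M] leaves a pairing of the conjugated [M] with the
    fixed kernel [tens f f]. *)
Lemma quad_weyl_sbound M f (c : R) : 0 <= c -> sqn f <= 1 -> sbound M c ->
  dsum (fun t k => normc (quad M (weyl t k f)) ^+ 2) <= c ^+ 2.
Proof.
move=> c0 f1 Mc; have := weyl_conj_sbound (tens f f) Mc.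
rewrite hs2_tens => h; apply: le_trans (le_trans h _); last first.
  by rewrite ler_piMr ?sqr_ge0 // mulr_ile1 ?sqn_ge0.
rewrite le_eqVlt; apply/orP; left; apply/eqP.
apply: eq_dsum => t k; congr (normc _ ^+ 2).
rewrite quad_hs /hs (shift_avg t); apply: eq_avg => x.
rewrite (shift_avg t); apply: eq_avg => y.
rewrite /tens /weyl !addrK ch_sub !rmorphM /= !conjCK; ring.
Qed.

Lemma dsum_avgr (T : finType) (F : T -> Z -> K -> R) :
  dsum (fun t k => avgr (fun x => F x t k)) = avgr (fun x => dsum (F x)).
Proof.
rewrite /dsum exchange_avgr; apply: eq_avgr => t.
by rewrite avgr_sum.
Qed.

(** With [U] the Weyl operator, this is the form of [G = A (U M U^-1) A] at [U f]. Each entry of [G]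
    pairs the conjugated [M] with a kernel [P x y] independent of [(t, k)], so Plancherel applies
    entrywise; [U f] enters only through its norm. *)
Lemma quad_weyl_adj_sbound A M f (c : R) : 0 <= c -> sqn f <= 1 -> selfadjoint (app A) ->
  hs2 A <= 1 -> sbound M c ->
  dsum (fun t k => normc (quad M (weyl_adj t k (app A (weyl t k f)))) ^+ 2) <= c ^+ 2.
Proof.
move=> c0 f1 hA A1 Mc.
pose P x y p q := (A x p)^* * (A q y)^*.
pose G t k x y := avg (fun p => avg (fun q =>
    M (p - t) (q - t) * ch k (p - q) * (P x y p q)^*)).
have qE t k v : quad M (weyl_adj t k (app A v)) = quad (G t k) v.
  rewrite /quad innerC inner_weyl -innerC -hA.
  apply: eq_inner => // x; rewrite /app.
  under [RHS]eq_avg do rewrite -avgMr.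
  rewrite [RHS]exchange_avg; apply: eq_avg => p.
  under [RHS]eq_avg do rewrite -avgMr.
  rewrite [RHS]exchange_avg /weyl -!avgMl (shift_avg (- t)); apply: eq_avg => q.
  rewrite /weyl_adj subrK -!avgMl; apply: eq_avg => y.
  have -> : p - q = p - t - (q - t) by rewrite opprB addrA subrK.
  rewrite [ch k (p - t - _)]ch_sub /P rmorphM /= !conjCK. ring.
have h : dsum (fun t k => hs2 (G t k)) <= c ^+ 2.
  rewrite /hs2 dsum_avgr.
  under eq_avgr do rewrite dsum_avgr.
  apply: le_trans (_ : avgr (fun x => avgr (fun y => c ^+ 2 * hs2 (P x y))) <= _).
    apply: ler_avgr => x; apply: ler_avgr => y; exact: weyl_adj_conj_sbound.
  under eq_avgr do rewrite avgrMl.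
  rewrite avgrMl ler_piMr ?sqr_ge0 //.
  have -> : avgr (fun x => avgr (fun y => hs2 (P x y))) = hs2 A * hs2 A.
    rewrite /hs2 -avgrMr; apply: eq_avgr => x.
    rewrite [X in _ = _ * X]exchange_avgr -avgrMl; apply: eq_avgr => y.
    rewrite -avgrMr; apply: eq_avgr => p; rewrite -avgrMl; apply: eq_avgr => q.
    by rewrite normcM !normc_conj exprMn.
  by rewrite mulr_ile1 ?hs2_ge0.
apply: le_trans h; apply: ler_dsum => t k; rewrite qE quad_hs.
apply: le_trans (hs_cs ch_onb _ _) _; rewrite ler_piMr ?hs2_ge0 //.
by rewrite hs2_tens sqn_weyl mulr_ile1 ?sqn_ge0.
Qed.

End Weyl.

(** * The self-improving estimate *)

Section Key.
Import ComplexField.Normc.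
Variable R : realType.
Local Notation C := (complex R).
Local Notation "x %:C" := (real_complex R x) : ring_scope.
Variable Z : finZmodType.
Local Notation diagonal := Defs.diagonal.
Local Notation K := 'I_#|Z|.
Variable ch : K -> Z -> C.
Hypothesis ch_onb : onb ch.
Hypothesis chD : forall k, dual_group (ch k).

Section Decomposition.
Variables (f : Z -> C) (A E B : Z -> Z -> C) (rho sigma delta eta theta : R).
Hypothesis f1 : sqn f <= 1.
Hypothesis fE : forall x y, tens f f x y = A x y + E x y + B x y.
Hypothesis hA : selfadjoint (app A).
Hypothesis A1 : hs2 A <= 1.
Hypothesis delta0 : 0 <= delta.
Hypothesis Edelta : hs2 E <= delta ^+ 2.
Hypothesis eta0 : 0 <= eta.
Hypothesis Beta : sbound ch B eta.
Hypothesis ABtheta : normc (hs A B) <= theta.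
Hypothesis rho0 : 0 <= rho.
Hypothesis rho1 : rho <= 1.
Hypothesis sigma0 : 0 <= sigma.
Hypothesis quadA : forall w, complex.Re (quad A w) <= rho * sqn w.
Hypothesis sqnA : forall w, sqn (app A w) <= rho * complex.Re (quad A w) + sigma * sqn w.

Let V t k := normc (coef ch (tens f f) t k).

Lemma coef_split t k :
  coef ch (tens f f) t k = coef ch A t k + coef ch E t k + coef ch B t k.
Proof.
rewrite /coef -!innerDl; apply: eq_inner => // x; exact: fE.
Qed.

Lemma V_ge0 t k : 0 <= V t k. Proof. exact: normc_ge0. Qed.

Lemma V_le1 t k : V t k <= 1.
Proof. exact: normc_coef_tens_le1. Qed.

Lemma dsum_V2 : dsum (fun t k => V t k ^+ 2) <= 1.
Proof. exact: dsum_coef_tens_le1. Qed.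

Lemma V_exp_le t k n : (2 <= n)%N -> V t k ^+ n <= V t k ^+ 2.
Proof. by move=> n2; apply: ler_wiXn2l; rewrite ?V_ge0 ?V_le1. Qed.

Lemma dsum_VX n : (2 <= n)%N -> dsum (fun t k => V t k ^+ n) <= 1.
Proof.
by move=> n2; apply: le_trans dsum_V2; apply: ler_dsum => t k; apply: V_exp_le.
Qed.

(** Pair the decomposition with [A]: [hs A (tens f f)] is the quadratic form of [A] at [f], at most
    [rho], and the pairings with [E] and [B] are errors of size [delta] and [theta]. *)
Lemma hs2_structured_le : hs2 A <= rho + delta + theta.
Proof.
have hsD : hs A (tens f f) = hs A A + hs A E + hs A B.
  rewrite /hs -!avgD; apply: eq_avg => x; rewrite -!avgD; apply: eq_avg => y.
  by rewrite fE !rmorphD /=; ring.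
have q1 : complex.Re (hs A (tens f f)) <= rho.
  by rewrite -quad_hs; apply: le_trans (quadA f) _; rewrite ler_piMr.
have e1 : normc (hs A E) <= delta.
  rewrite -ler_sqr ?nnegrE ?normc_ge0 //; apply: le_trans (hs_cs ch_onb _ _) _.
  by apply: le_trans Edelta; rewrite ler_piMl ?hs2_ge0.
have := normr_Re_le (hs A E); have := normr_Re_le (hs A B).
move: q1; rewrite hsD hsxx !raddfD /= !ler_norml => q1 /andP[b1 b2] /andP[b3 b4].
move: ABtheta; lra.
Qed.

Lemma dsum_cs_le F G (a b : R) : 0 <= a -> 0 <= b ->
  dsum (fun t k => F t k ^+ 2) <= a ^+ 2 -> dsum (fun t k => G t k ^+ 2) <= b ^+ 2 ->
  @dsum R Z (fun t k => F t k * G t k) <= a * b.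
Proof.
move=> a0 b0 Fa Gb; apply: le_trans (ler_norm _) _.
rewrite -ler_sqr ?nnegrE ?mulr_ge0 // real_normK ?num_real //.
apply: le_trans (dsum_cs _ _) _; rewrite exprMn ler_pM //;
  by apply: dsum_ge0 => t k; rewrite sqr_ge0.
Qed.

(** One of the four factors [V] in [u3] is split along the decomposition. The part from [E] costs
    [delta] by Cauchy-Schwarz, the part from [B] costs [eta] by the uniform bound, and [W] pairs the
    coefficients of [A] with [V ^+ 3]. *)
Lemma u3_le_sqrt : exists2 W : R, u3 ch f <= W + delta + eta &
  W ^+ 2 <= hs2 A * dsum (fun t k => V t k ^+ 6).
Proof.
exists (dsum (fun t k => normc (coef ch A t k) * V t k ^+ 3)); last first.
  apply: le_trans (dsum_cs _ _) _; rewrite -(hs2_coef ch_onb).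
  rewrite le_eqVlt; apply/orP; left; apply/eqP; congr (_ * _).
  by apply: eq_dsum => t k; rewrite -exprM.
have eE : dsum (fun t k => normc (coef ch E t k) * V t k ^+ 3) <= delta.
  rewrite -[delta]mulr1; apply: dsum_cs_le; rewrite -?(hs2_coef ch_onb) ?ler01 //.
  rewrite expr1n; apply: le_trans (dsum_VX (n := 6) _) => //.
  by rewrite le_eqVlt; apply/orP; left; apply/eqP; apply: eq_dsum => t k; rewrite -exprM.
have eB : dsum (fun t k => normc (coef ch B t k) * V t k ^+ 3) <= eta.
  apply: le_trans (_ : dsum (fun t k => eta * V t k ^+ 3) <= _).
    apply: ler_dsum => t k; apply: ler_wpM2r; first by rewrite exprn_ge0 ?V_ge0.
    exact: Beta.
  by rewrite dsumMl ler_piMr // dsum_VX.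
apply: le_trans (_ : _ <= dsum (fun t k => normc (coef ch A t k) * V t k ^+ 3) +
  dsum (fun t k => normc (coef ch E t k) * V t k ^+ 3) +
  dsum (fun t k => normc (coef ch B t k) * V t k ^+ 3)) _; last by lra.
rewrite -!dsumD; apply: ler_dsum => t k; rewrite -!mulrDl exprS.
apply: ler_wpM2r; first by rewrite exprn_ge0 ?V_ge0.
rewrite coef_split; apply: le_trans (le_normcD _ _) _; rewrite lerD2r.
exact: le_normcD.
Qed.

Lemma quad_split w : quad (tens f f) w = quad A w + quad E w + quad B w.
Proof.
rewrite /quad -!innerDl; apply: eq_inner => // x; rewrite /app -!avgD.
by apply: eq_avg => y; rewrite fE; ring.
Qed.

(* With [w] a Weyl translate of [f] and [z = A w], the number
   [v = quad A w] is close to [V ^ 2], while [v ^ 2] is the quadratic form of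
   [tens f f] at a translate [u] of [z], hence close to
   [quad A u <= rho * sqn z <= rho * (rho * v + sigma)]. *)
Lemma dsum_V6_le : dsum (fun t k => V t k ^+ 6) <=
  rho ^+ 2 * u3 ch f + 4 * delta + 4 * eta + sigma.
Proof.
pose b1 t k := normc (quad B (weyl ch t k f)).
pose b2 t k := normc (quad B (weyl_adj ch t k (app A (weyl ch t k f)))).
have hb1 : dsum (fun t k => V t k ^+ 2 * b1 t k) <= eta.
  rewrite -[eta]mul1r; apply: dsum_cs_le; rewrite ?ler01 ?expr1n //.
    apply: le_trans (dsum_VX (n := 4) _) => //.
    by rewrite le_eqVlt; apply/orP; left; apply/eqP; apply: eq_dsum => t k; rewrite -exprM.
  exact: quad_weyl_sbound.
have hb2 : dsum (fun t k => V t k ^+ 2 * b2 t k) <= eta.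
  rewrite -[eta]mul1r; apply: dsum_cs_le; rewrite ?ler01 ?expr1n //.
    apply: le_trans (dsum_VX (n := 4) _) => //.
    by rewrite le_eqVlt; apply/orP; left; apply/eqP; apply: eq_dsum => t k; rewrite -exprM.
  exact: quad_weyl_adj_sbound.
have pw t k : V t k ^+ 4 <=
    rho ^+ 2 * V t k ^+ 2 + (4 * delta + sigma) + 3 * b1 t k + b2 t k.
  have V0 := V_ge0 t k; have V1 := V_le1 t k.
  set w := weyl ch t k f; set z := app A w; set u := weyl_adj ch t k z.
  have w1 : sqn w <= 1 by rewrite sqn_weyl.
  have z1 : sqn z <= 1.
    by apply: le_trans (sqn_app_le _ _) _; rewrite mulr_ile1 ?hs2_ge0 ?sqn_ge0.
  have u1 : sqn u = sqn z by rewrite sqn_weyl_adj.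
  set v := complex.Re (quad A w).
  have vle : v ^+ 2 <= complex.Re (quad (tens f f) u).
    rewrite quad_tens /= innerC /u inner_weyl // normc_conj.
    rewrite -[inner z _]/(quad A w) -[v ^+ 2]real_normK ?num_real //.
    by rewrite ler_sqr ?nnegrE ?normr_ge0 ?normc_ge0 // normr_Re_le.
  have VV : V t k ^+ 2 = complex.Re (quad (tens f f) w).
    by rewrite quad_tens /V coef_tens.
  have v1 : `|v| <= 1.
    apply: le_trans (normr_Re_le _) _; rewrite -[leRHS]mulr1.
    by apply: (normc_quad_le ch_onb); rewrite ?ler01 ?expr1n.
  have ew : normc (quad E w) <= delta.
    by rewrite -[delta]mulr1; apply: (normc_quad_le ch_onb).
  have eu : normc (quad E u) <= delta.
    by rewrite -[delta]mulr1; apply: (normc_quad_le ch_onb); rewrite // u1.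
  have := le_trans (normr_Re_le _) ew; have := le_trans (normr_Re_le _) eu.
  have := normr_Re_le (quad B w); have := normr_Re_le (quad B u).
  rewrite -/(b1 t k) -/(b2 t k).
  move: vle VV (quadA u) (sqnA w).
  rewrite !quad_split !raddfD /= -/v -/z u1 !ler_norml.
  move: (complex.Re (quad E w)) (complex.Re (quad E u)) => re1 re2.
  move: (complex.Re (quad B w)) (complex.Re (quad B u)) => rb1 rb2.
  move: (complex.Re (quad A u)) => ra.
  move: v1; rewrite ler_norml => /andP[v1 v2].
  move=> vle VV qA sA /andP[x1 x2] /andP[x3 x4] /andP[x5 x6] /andP[x7 x8].
  have b10 : 0 <= b1 t k by exact: normc_ge0.
  have b20 : 0 <= b2 t k by exact: normc_ge0.
  have s1 : sqn z <= rho * v + sigma.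
    by apply: le_trans sA _; rewrite lerD2l ler_piMr.
  have r1 : rho * sqn z <= rho ^+ 2 * v + sigma.
    rewrite expr2 -mulrA; apply: le_trans (ler_wpM2l rho0 s1) _.
    by rewrite mulrDr lerD2l ler_piMl.
  have r2 : rho ^+ 2 * v <= rho ^+ 2 * V t k ^+ 2 + (delta + b1 t k).
    have : rho ^+ 2 * (v - V t k ^+ 2) <= delta + b1 t k.
      apply: le_trans (_ : rho ^+ 2 * (delta + b1 t k) <= _).
        by apply: ler_wpM2l; [rewrite sqr_ge0 | lra].
      by rewrite ler_piMl ?addr_ge0 // exprn_ile1.
    by rewrite mulrBr; lra.
  (* Passing from [v ^+ 2] to [V ^+ 4] costs a difference of squares, where [V ^+ 2] and [v] have
     modulus at most 1. *)
  have r3 : (V t k ^+ 2 - v) * (V t k ^+ 2 + v) <= 2 * (delta + b1 t k).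
    have V21 : V t k ^+ 2 <= 1 by rewrite exprn_ile1.
    have V20 : 0 <= V t k ^+ 2 by rewrite sqr_ge0.
    apply: le_trans (ler_norm _) _; rewrite normrM mulrC ler_pM ?normr_ge0 //.
      by rewrite ler_norml; lra.
    by rewrite ler_norml; lra.
  have -> : V t k ^+ 4 = v ^+ 2 + (V t k ^+ 2 - v) * (V t k ^+ 2 + v) by ring.
  lra.
(* The pointwise bound is multiplied by [V ^+ 2] before summing: constants then cost only the second
   moment of [V], and [b1], [b2] cost only [eta] by Cauchy-Schwarz. *)
apply: le_trans (_ : dsum (fun t k => rho ^+ 2 * V t k ^+ 4 +
   (4 * delta + sigma) * V t k ^+ 2 + 3 * (V t k ^+ 2 * b1 t k) +
   V t k ^+ 2 * b2 t k) <= _).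
  apply: ler_dsum => t k.
  have -> : V t k ^+ 6 = V t k ^+ 2 * V t k ^+ 4 by ring.
  apply: le_trans (ler_wpM2l (sqr_ge0 _) (pw t k)) _.
  rewrite le_eqVlt; apply/orP; left; apply/eqP; ring.
rewrite !dsumD !dsumMl -/(u3 ch f).
have : (4 * delta + sigma) * dsum (fun t k => V t k ^+ 2) <= 4 * delta + sigma.
  by rewrite ler_piMr ?dsum_V2 // addr_ge0 // mulr_ge0.
lra.
Qed.

End Decomposition.
End Key.

(** * The denoising operator *)

Section Denoise.
Import ComplexField.Normc.
Variable R : realType.
Local Notation C := (complex R).
Local Notation "x %:C" := (real_complex R x) : ring_scope.
Variable Z : finZmodType.
Local Notation diagonal := Defs.diagonal.
Local Notation K := 'I_#|Z|.
Variable ch : K -> Z -> C.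
Hypothesis ch_onb : onb ch.
Hypothesis ch_inj : injective ch.
Hypothesis chs : forall chi, dual_group chi <-> exists k, chi = ch k.
Implicit Types (f g h v w : Z -> C) (M N A : Z -> Z -> C) (eps r : R).

Lemma chD k : dual_group (ch k).
Proof. by apply/chs; exists k. Qed.

Lemma ch_conj : exists2 J : K -> K, involutive J &
  forall k, ch (J k) = fun x => (ch k x)^*.
Proof.
have h k : exists j, ch j = fun x => (ch k x)^*.
  have /chs[j ->] := dual_groupJ (chD k); by exists j.
have [J JE] := choice h; exists J => // k.
by apply: ch_inj; rewrite !JE; apply/funext => x; rewrite conjCK.
Qed.

(** The factor by which soft thresholding scales a coefficient of modulus [r]. *)
Definition shrink eps r : R := if eps <= r then (r - eps) / r else 0.

Lemma denoiseE eps g x : denoise eps g x =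
  \sum_k (shrink eps (normc (inner g (ch k))))%:C * inner g (ch k) * ch k x.
Proof.
pose P : pred K := fun k => eps <= normc (inner g (ch k)).
rewrite /denoise (reindex_fsbig ch [set` P]%classic); last first.
  split.
  - by move=> k /= Pk; split => //; exact: chD.
  - by move=> i j _ _; exact: ch_inj.
  - by move=> chi [/chs[k ->] /= Pk]; exists k.
rewrite -(@bigfs _ _ _ _ (index_enum K)) ?index_enum_uniq // => [|k _]; last first.
  by rewrite mem_index_enum.
rewrite big_mkcond; apply: eq_bigr => k _.
by rewrite /P /shrink; case: ifP => // _; rewrite rmorph0 !mul0r.
Qed.

Lemma coef_denoise eps M t k : coef ch (denoise_mx eps M) t k =
  (shrink eps (normc (coef ch M t k)))%:C * coef ch M t k.
Proof.
have E : diagonal (denoise_mx eps M) t =1 denoise eps (diagonal M t).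
  by move=> z; rewrite /Defs.diagonal /denoise_mx addrAC subrr add0r.
rewrite /coef (eq_inner E (frefl _)) (eq_inner (denoiseE eps _) (frefl _)).
rewrite inner_suml (bigD1 k) //= big1 ?addr0 => [|j jk].
  by rewrite innerZl ch_onb.1 eqxx mulr1.
by rewrite innerZl ch_onb.1 (negbTE jk) mulr0.
Qed.

Lemma shrinkM eps r : 0 < eps -> 0 <= r -> shrink eps r * r = Num.max (r - eps) 0.
Proof.
move=> e0 r0; rewrite /shrink; case: (lerP eps r) => er.
  rewrite divfK; first by rewrite max_l // subr_ge0.
  by rewrite gt_eqF // (lt_le_trans e0).
by rewrite mul0r max_r // subr_le0 ltW.
Qed.

Lemma shrink_ge0 eps r : 0 < eps -> 0 <= r -> 0 <= shrink eps r.
Proof.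
move=> e0 r0; rewrite /shrink; case: (lerP eps r) => er //.
by rewrite divr_ge0 // subr_ge0.
Qed.

Lemma normc_coef_denoise eps M t k : 0 < eps ->
  normc (coef ch (denoise_mx eps M) t k) = Num.max (normc (coef ch M t k) - eps) 0.
Proof.
move=> e0; rewrite coef_denoise normcM normc_real.
by rewrite ger0_norm ?shrink_ge0 ?normc_ge0 // shrinkM // normc_ge0.
Qed.

Definition subk M N : Z -> Z -> C := fun x y => M x y - N x y.

Lemma coef_subk M N t k : coef ch (subk M N) t k = coef ch M t k - coef ch N t k.
Proof. by rewrite /coef -innerBl. Qed.

(** Soft thresholding moves a coefficient of modulus [r] by the minimum of [r] and [eps]. *)
Lemma sbound_denoise eps M : 0 < eps -> sbound ch (subk M (denoise_mx eps M)) eps.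
Proof.
move=> e0 t k; rewrite coef_subk coef_denoise; set c := coef ch M t k.
have c0 := normc_ge0 c.
have -> : c - (shrink eps (normc c))%:C * c = (1 - shrink eps (normc c))%:C * c.
  by rewrite rmorphB rmorph1 mulrBl mul1r.
have sh1 : shrink eps (normc c) <= 1.
  rewrite /shrink; case: (lerP eps (normc c)) => // er.
  by rewrite ler_pdivrMr ?mul1r ?gerBl ?(ltW e0) // (lt_le_trans e0).
rewrite normcM normc_real ger0_norm ?subr_ge0 // mulrBl mul1r shrinkM //.
by case: (leP (normc c - eps) 0) => h; lra.
Qed.

Lemma normc_coef_denoise_le eps M t k : 0 < eps ->
  normc (coef ch (denoise_mx eps M) t k) <= normc (coef ch M t k).
Proof.
by move=> e0; rewrite normc_coef_denoise // ge_max normc_ge0 gerBl (ltW e0).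
Qed.

Lemma hs2_denoise_le eps M : 0 < eps -> hs2 (denoise_mx eps M) <= hs2 M.
Proof.
move=> e0; rewrite !(hs2_coef ch_onb); apply: ler_dsum => t k.
by rewrite ler_sqr ?nnegrE ?normc_ge0 // normc_coef_denoise_le.
Qed.

(** Both thresholded coefficients share the phase of the original, and [0 <= a <= a'] implies
    [(a' - a) ^+ 2 <= a' ^+ 2 - a ^+ 2]. Squared norms therefore telescope along decreasing
    thresholds. *)
Lemma hs2_denoise_sub eps eps' M : 0 < eps' -> eps' <= eps ->
  hs2 (subk (denoise_mx eps' M) (denoise_mx eps M)) <=
  hs2 (denoise_mx eps' M) - hs2 (denoise_mx eps M).
Proof.
move=> e0' ee; have e0 := lt_le_trans e0' ee.
rewrite lerBrDr !(hs2_coef ch_onb) -dsumD; apply: ler_dsum => t k.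
rewrite coef_subk !coef_denoise; move: (coef ch M t k) => z.
rewrite -mulrBl -rmorphB !normcM !normc_real; set c := normc z.
have c0 : 0 <= c by exact: normc_ge0.
rewrite !exprMn !real_normK ?num_real // -!exprMn mulrBl !shrinkM //.
have [h1|h1] := leP c eps'; have [h2|h2] := leP c eps.
- by rewrite !max_r ?subr_le0 //; lra.
- by rewrite !max_r ?subr_le0 //; lra.
- rewrite (max_r (x := c - eps)) ?subr_le0 // max_l ?subr_ge0 ?(ltW h1) //; lra.
- rewrite !max_l ?subr_ge0 ?(ltW h1) ?(ltW h2) //.
  have : 0 <= (c - eps) * (eps - eps').
    by rewrite mulr_ge0 // subr_ge0 // ltW.
  nra.
Qed.

(** A surviving coefficient has modulus [c > eps], so [c - eps <= c ^+ 2 / eps]; this trades an l^1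
    sum for an l^2 sum. *)
Lemma normc_coef_denoise_sq eps M t k : 0 < eps ->
  normc (coef ch (denoise_mx eps M) t k) <= eps^-1 * normc (coef ch M t k) ^+ 2.
Proof.
move=> e0; rewrite normc_coef_denoise // mulrC ler_pdivlMr //.
set c := normc (coef ch M t k); have c0 : 0 <= c by exact: normc_ge0.
have [h|h] := leP c eps; first by rewrite max_r ?subr_le0 // mul0r sqr_ge0.
by rewrite max_l ?subr_ge0 ?(ltW h) //; nra.
Qed.

(** Parseval on one diagonal, whose entries [f (z + t) * (f z)^*] have modulus at most 1. *)
Lemma sum_coef_denoise eps f t : 0 < eps -> one_bounded f ->
  \sum_k normc (coef ch (denoise_mx eps (tensor_conj f)) t k) <= eps^-1.
Proof.
move=> e0 f1.
apply: le_trans (_ : \sum_k eps^-1 * normc (coef ch (tensor_conj f) t k) ^+ 2 <= _).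
  by apply: ler_sum => k _; exact: normc_coef_denoise_sq.
rewrite -mulr_sumr -(parseval_sqn _ ch_onb) ler_piMr ?invr_ge0 ?(ltW e0) //.
have n1 x : normc (f x) <= 1 by rewrite -lecR normcE_norm rmorph1 f1.
apply: le_trans (_ : avgr (fun _ : Z => 1) <= _); last by rewrite avgr_cst.
apply: ler_avgr => z.
by rewrite exprn_ile1 ?normc_ge0 // normcM normc_conj mulr_ile1 ?normc_ge0.
Qed.

(** The coefficients of [N] at [(- t, k)] and [(t, J k)] are conjugate up to a unimodular factor,
    where [J] conjugates characters. Thresholding depends on the modulus alone, so it keeps this
    symmetry. *)
Lemma hermitian_denoise eps f : hermitian_kernel (denoise_mx eps (tensor_conj f)).
Proof.
have [J JK JE] := ch_conj; set N := tensor_conj f.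
have cN t k : coef ch N (- t) k = (ch k t)^* * (coef ch N t (J k))^*.
  rewrite /coef [in RHS]avg_conj -avgMl [LHS](shift_avg t); apply: eq_avg => z.
  rewrite JE /Defs.diagonal /N /tensor_conj addrK !rmorphM /= !conjCK.
  by have [_ ->] := chD k; rewrite rmorphM /=; ring.
move=> x y; rewrite /denoise_mx !denoiseE rmorph_sum (reindex J) /=; last first.
  exact/onW_bij/inv_bij.
apply: eq_bigr => k _; rewrite -(opprB x y) -![inner (diagonal N _) _]/(coef ch N _ _).
rewrite cN JK JE; move: (coef ch N (x - y) k) => d.
rewrite !rmorphM /= !conjCK normcM normc_conj.
rewrite dual_group_normc ?mul1r; last exact: chD.
rewrite conjC_real (ch_sub chD).
have E : ch k x * (ch k x)^* = 1.
  by rewrite -normc_sqr dual_group_normc ?expr1n ?rmorph1 //; exact: chD.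
set s := (shrink _ _)%:C; set c := d^*.
transitivity (s * c * (ch k y)^* * (ch k x * (ch k x)^*)); first by ring.
by rewrite E mulr1.
Qed.

Definition lmul A M : Z -> Z -> C := fun x y => app A (fun z => M z y) x.
Definition adjk M : Z -> Z -> C := fun x y => (M y x)^*.

Lemma sbound_char M (c : R) s chi : sbound ch M c -> dual_group chi ->
  normc (inner (diagonal M s) chi) <= c.
Proof. by move=> Mc /chs[k ->]; exact: Mc. Qed.

(* The diagonals of a product are averages of products of diagonals. *)
Lemma sbound_lmul A M (W c : R) :
  (forall t, \sum_k normc (coef ch A t k) <= W) -> sbound ch M c ->
  sbound ch (lmul A M) (W * c).
Proof.
move=> AW Mc t k.
have c0 : 0 <= c by exact: le_trans (normc_ge0 _) (Mc t k).
have -> : coef ch (lmul A M) t k = avg (fun s => \sum_j coef ch A (t - s) j *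
    ch j s * inner (diagonal M s) (fun y => (ch j y)^* * ch k y)).
  rewrite /coef /inner /lmul /Defs.diagonal /app.
  under eq_avg do rewrite -avgMr.
  transitivity (avg (fun y => avg (fun s =>
      A (y + t) (s + y) * M (s + y) y * (ch k y)^*))).
    by apply: eq_avg => y; exact: shift_avg.
  rewrite exchange_avg; apply: eq_avg => s.
  transitivity (avg (fun y => \sum_j coef ch A (t - s) j * ch j s *
     (M (y + s) y * ((ch j y)^* * ch k y)^*))); last first.
    by rewrite avg_sum; apply: eq_bigr => j _; rewrite avgMl.
  apply: eq_avg => y.
  have -> : A (y + t) (s + y) = diagonal A (t - s) (y + s).
    by rewrite /Defs.diagonal addrACA subrr addr0 [s + y]addrC.
  rewrite (ch_onb.2 (diagonal A (t - s))) -mulrA mulr_suml; apply: eq_bigr => j _.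
  have [_ ->] := chD j; rewrite [s + y]addrC rmorphM /= conjCK /coef; ring.
apply: le_trans (normc_dsum _) _.
apply: le_trans (_ : avgr (fun s : Z => W * c) <= _); last by rewrite avgr_cst.
apply: ler_avgr => s; apply: le_trans (ler_wpM2r c0 (AW (t - s))).
rewrite mulr_suml; apply: ler_sum => j _.
rewrite normcM [normc (coef _ _ _ _ * _)]normcM (dual_group_normc _ (chD j)) mulr1.
apply: ler_wpM2l; first exact: normc_ge0.
apply: sbound_char => //; split=> [x|x y].
  by rewrite normrM norm_conjC (chD j).1 (chD k).1 mulr1.
by rewrite (chD j).2 (chD k).2 rmorphM /=; ring.
Qed.

(** Up to phase and conjugation, the coefficients of the adjoint are those of [M] at [- t] and the
    conjugate character. *)
Lemma sbound_adjk M (c : R) : sbound ch M c -> sbound ch (adjk M) c.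
Proof.
move=> Mc t k.
have -> : coef ch (adjk M) t k =
    ch k t * (inner (diagonal M (- t)) (fun z => (ch k z)^*))^*.
  rewrite /coef avg_conj -avgMl [RHS](shift_avg t); apply: eq_avg => z.
  rewrite /Defs.diagonal /adjk addrK !rmorphM /= conjCK.
  rewrite (chD k).2 rmorphM /=.
  have E : ch k t * (ch k t)^* = 1.
    by rewrite -normc_sqr dual_group_normc ?expr1n ?rmorph1 //; exact: chD.
  transitivity ((M z (z + t))^* * (ch k z)^* * (ch k t * (ch k t)^*)); last by ring.
  by rewrite E mulr1.
rewrite normcM normc_conj (dual_group_normc _ (chD k)) mul1r.
by apply: sbound_char => //; exact/dual_groupJ/chD.
Qed.

Lemma sbound_subk M N (a b : R) : sbound ch M a -> sbound ch N b ->
  sbound ch (subk M N) (a + b).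
Proof.
move=> Ma Nb t k; rewrite coef_subk; apply: le_trans (le_normcD _ _) _.
by rewrite normcN lerD.
Qed.

(** Duality of l^1 and l^infinity on each diagonal. *)
Lemma normc_hs_sbound A M (W c : R) : (forall t, \sum_k normc (coef ch A t k) <= W) ->
  0 <= c -> sbound ch M c -> normc (hs A M) <= W * c.
Proof.
move=> AW c0 Mc; apply: le_trans (normc_hs_le ch_onb _ _) _.
apply: le_trans (_ : avgr (fun _ : Z => W * c) <= _); last by rewrite avgr_cst.
apply: ler_avgr => t.
apply: le_trans (ler_wpM2r c0 (AW t)); rewrite mulr_suml.
by apply: ler_sum => k _; rewrite ler_wpM2l ?normc_ge0.
Qed.

Lemma u3_le_sqn f : u3 ch f <= sqn f ^+ 4.
Proof.
have -> : sqn f ^+ 4 = (sqn f ^+ 2) * (sqn f * sqn f) by ring.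
rewrite -hs2_tens (hs2_coef ch_onb) -dsumMl; apply: ler_dsum => t k.
have -> : normc (coef ch (tens f f) t k) ^+ 4 =
  normc (coef ch (tens f f) t k) ^+ 2 * normc (coef ch (tens f f) t k) ^+ 2 by ring.
apply: ler_wpM2r; first exact: sqr_ge0.
rewrite coef_tens // ?expr2 -expr2.
by apply: le_trans (inner_cs _ _) _; rewrite sqn_weyl ?expr2 //; exact: chD.
Qed.

(** A coefficient of the denoised kernel is at most [V ^+ 2 / eps], so the pairing is at most
    [S / eps]. Two uses of Cauchy-Schwarz remove the moments of [V], and a third, on the cube,
    bounds the fourth moment of [G]. *)
Lemma inner_app_denoise eps f g w : 0 < eps -> sqn f <= 1 ->
  normc (inner (app (denoise_mx eps (tensor_conj f)) w) g) ^+ 8 <=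
  eps^-1 ^+ 8 * (u3 ch g * u3 ch w).
Proof.
move=> e0 f1; set A := denoise_mx _ _.
have ei : 0 <= eps^-1 by rewrite invr_ge0 ltW.
pose V t k := normc (coef ch (tens f f) t k).
pose G t k := normc (coef ch (tens g w) t k).
pose S := dsum (fun t k => V t k * (V t k * G t k)).
have S0 : 0 <= S by apply: dsum_ge0 => t k; rewrite !mulr_ge0 ?normc_ge0.
have h1 : normc (inner (app A w) g) <= eps^-1 * S.
  rewrite inner_app_hs; apply: le_trans (normc_hs_le ch_onb _ _) _.
  rewrite -dsumMl; apply: ler_dsum => t k; rewrite !mulrA; apply: ler_wpM2r.
    exact: normc_ge0.
  by rewrite -mulrA -expr2; exact: normc_coef_denoise_sq.
have V1 t k : V t k <= 1 by apply: normc_coef_tens_le1 => //; exact: chD.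
have V2 : dsum (fun t k => V t k ^+ 2) <= 1 by exact: dsum_coef_tens_le1.
have h2 : S ^+ 2 <= dsum (fun t k => V t k ^+ 2 * G t k ^+ 2).
  apply: le_trans (dsum_cs _ _) _; apply: le_trans (_ : _ <= 1 * _) _.
    apply: ler_wpM2r V2.
    by apply: dsum_ge0 => t k; rewrite sqr_ge0.
  rewrite mul1r le_eqVlt; apply/orP; left; apply/eqP.
  by apply: eq_dsum => t k; rewrite exprMn.
have h3 : (S ^+ 2) ^+ 2 <= dsum (fun t k => G t k ^+ 4).
  apply: le_trans (_ : dsum (fun t k => V t k ^+ 2 * G t k ^+ 2) ^+ 2 <= _).
    by rewrite ler_sqr ?nnegrE ?sqr_ge0 // (le_trans _ h2) ?sqr_ge0.
  apply: le_trans (dsum_cs _ _) _; apply: le_trans (_ : _ <= 1 * _) _.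
    apply: ler_wpM2r; first by apply: dsum_ge0 => t k; rewrite sqr_ge0.
    apply: le_trans V2; apply: ler_dsum => t k; rewrite -exprM.
    by apply: ler_wiXn2l; rewrite ?normc_ge0 ?V1.
  rewrite mul1r le_eqVlt; apply/orP; left; apply/eqP.
  by apply: eq_dsum => t k; rewrite -exprM.
have h4 : ((S ^+ 2) ^+ 2) ^+ 2 <= u3 ch g * u3 ch w.
  apply: le_trans (tens_coef_fourth_le ch_onb chD g w).
  by rewrite ler_sqr ?nnegrE ?sqr_ge0 // (le_trans _ h3) ?sqr_ge0.
apply: le_trans (_ : (eps^-1 * S) ^+ 8 <= _).
  apply: lerXn2r h1; rewrite nnegrE ?normc_ge0 //; exact: mulr_ge0.
rewrite exprMn ler_wpM2l ?exprn_ge0 //.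
by move: h4; rewrite -!exprM.
Qed.

End Denoise.

(** * Functional calculus *)

Section Calculus.
Import ComplexField.Normc.
Variable R : realType.
Local Notation C := (complex R).
Local Notation "x %:C" := (real_complex R x) : ring_scope.
Variable Z : finZmodType.
Local Notation diagonal := Defs.diagonal.
Implicit Types (f g h v w : Z -> C) (M N : Z -> Z -> C).

Section Diagonal.
Variable I : finType.
Variable e : I -> Z -> C.
Hypothesis e_onb : onb e.

Lemma onb_ext f g : (forall i, inner f (e i) = inner g (e i)) -> f = g.
Proof.
by move=> fg; apply/funext => x; rewrite (e_onb.2 f) (e_onb.2 g);
  apply: eq_bigr => i _; rewrite fg.
Qed.

Definition diag_op (S : (Z -> C) -> Z -> C) (s : I -> R) : Prop :=
  forall v i, inner (S v) (e i) = (s i)%:C * inner v (e i).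

Section DiagOp.
Variables (S : (Z -> C) -> Z -> C) (s : I -> R).
Hypothesis Ss : diag_op S s.

Lemma diag_op_selfadjoint : selfadjoint S.
Proof.
move=> v w; rewrite !(parseval _ _ e_onb); apply: eq_bigr => i _.
rewrite !Ss; move: (inner v _) (inner w _) => a b.
by rewrite rmorphM /= conjC_real; ring.
Qed.

Lemma sqn_diag_op v : sqn (S v) = \sum_i s i ^+ 2 * normc (inner v (e i)) ^+ 2.
Proof.
rewrite (parseval_sqn _ e_onb); apply: eq_bigr => i _.
by rewrite Ss normcM normc_real exprMn real_normK ?num_real.
Qed.

Lemma Re_diag_op v :
  complex.Re (inner (S v) v) = \sum_i s i * normc (inner v (e i)) ^+ 2.
Proof.
rewrite (parseval _ _ e_onb) -[RHS]/(complex.Re (_%:C)); congr (complex.Re _).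
rewrite rmorph_sum; apply: eq_bigr => i _.
rewrite Ss; move: (inner v _) => a.
by rewrite -mulrA -normc_sqr -rmorphM.
Qed.

Lemma sqn_diag_op_le v (c : R) : 0 <= c -> (forall i, `|s i| <= c) ->
  sqn (S v) <= c ^+ 2 * sqn v.
Proof.
move=> c0 sc; rewrite sqn_diag_op (parseval_sqn v e_onb) mulr_sumr.
apply: ler_sum => i _; apply: ler_wpM2r; first exact: sqr_ge0.
by rewrite -real_normK ?num_real // ler_sqr ?nnegrE.
Qed.

Lemma diag_opZ a v : S (fun x => a * v x) = (fun x => a * S v x).
Proof. by apply: onb_ext => i; rewrite Ss !innerZl Ss mulrCA. Qed.

Lemma diag_opD v w : S (fun x => v x + w x) = (fun x => S v x + S w x).
Proof. by apply: onb_ext => i; rewrite Ss !innerDl !Ss mulrDr. Qed.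

(** Kernel of [S] composed with the operator of [M], see [app_colop]. *)
Definition colop M : Z -> Z -> C := fun x y => S (fun z => M z y) x.

Lemma hs2_col M : hs2 M = avgr (fun y => sqn (fun x => M x y)).
Proof. exact: exchange_avgr. Qed.

Lemma hs_col M N : hs M N = avg (fun y => inner (fun x => M x y) (fun x => N x y)).
Proof. exact: exchange_avg. Qed.

Lemma hs2_colop M (c : R) : 0 <= c -> (forall i, `|s i| <= c) ->
  hs2 (colop M) <= c ^+ 2 * hs2 M.
Proof.
move=> c0 sc; rewrite !hs2_col -avgrMl; apply: ler_avgr => y.
exact: sqn_diag_op_le.
Qed.

Lemma hs_colop M N : hs (colop M) N = hs M (colop N).
Proof. by rewrite !hs_col; apply: eq_avg => y; exact: diag_op_selfadjoint. Qed.

Lemma app_colop M v : app (colop M) v = S (app M v).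
Proof.
apply: onb_ext => i; rewrite Ss /inner /app.
under eq_avg do rewrite -avgMr.
under [X in _ * X]eq_avg do rewrite -avgMr.
rewrite exchange_avg [X in _ * X]exchange_avg -avgMl; apply: eq_avg => y.
transitivity (v y * inner (S (fun z => M z y)) (e i)).
  by rewrite -avgMl; apply: eq_avg => x; rewrite /colop; ring.
rewrite Ss mulrCA; congr (_ * _).
by rewrite -avgMl; apply: eq_avg => x; ring.
Qed.

Lemma colopD M N P : (forall x y, M x y = N x y + P x y) ->
  forall x y, colop M x y = colop N x y + colop P x y.
Proof.
move=> E x y; rewrite /colop.
have -> : (fun z => M z y) = (fun z => N z y + P z y) by apply/funext => z; exact: E.
by rewrite diag_opD.
Qed.

Lemma colop_tens f g : colop (tens f g) = tens (S f) g.
Proof.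
apply/funext => x; apply/funext => y; rewrite /colop /tens.
have -> : (fun z => f z * (g y)^*) = (fun z => (g y)^* * f z).
  by apply/funext => z; rewrite mulrC.
by rewrite diag_opZ mulrC.
Qed.

End DiagOp.

Lemma diag_op_comp S S' s s' : diag_op S s -> diag_op S' s' ->
  diag_op (fun v => S (S' v)) (fun i => s i * s' i).
Proof. by move=> hS hS' v i; rewrite hS hS' rmorphM mulrA. Qed.

Lemma diag_op_iter S s n : diag_op S s -> diag_op (iter n S) (fun i => s i ^+ n).
Proof.
move=> hS v i; elim: n => [|n IHn]; first by rewrite expr0 rmorph1 mul1r.
by rewrite iterS hS IHn exprS rmorphM mulrA.
Qed.

End Diagonal.

Lemma inner_adjk M v w : inner (app (adjk M) v) w = inner v (app M w).
Proof.
rewrite inner_app_hs innerC inner_app_hs /hs exchange_avg avg_conj.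
apply: eq_avg => x; rewrite avg_conj; apply: eq_avg => y.
by rewrite /adjk /tens !rmorphM /= !conjCK; ring.
Qed.

Lemma hs2_adjk M : hs2 (adjk M) = hs2 M.
Proof.
rewrite hs2_col; apply: eq_avgr => x; apply: eq_avgr => y.
by rewrite normc_conj.
Qed.

Lemma normc_hs_adjkl M N : normc (hs (adjk M) N) = normc (hs M (adjk N)).
Proof.
rewrite -normc_conj; congr normc; rewrite /hs exchange_avg avg_conj.
apply: eq_avg => x; rewrite avg_conj; apply: eq_avg => y.
by rewrite /adjk rmorphM /= !conjCK.
Qed.

Lemma adjkK M : adjk (adjk M) = M.
Proof. by apply/funext => x; apply/funext => y; rewrite /adjk conjCK. Qed.

Lemma adjk_tens f g : adjk (tens f g) = tens g f.
Proof.
by apply/funext => x; apply/funext => y; rewrite /adjk /tens rmorphM /= conjCK mulrC.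
Qed.

(* The kernel of [S M S] for a self-adjoint [S]. *)
Definition sandwich (S : (Z -> C) -> Z -> C) M : Z -> Z -> C :=
  adjk (colop S (adjk (colop S M))).

Section Sandwich.
Variable I : finType.
Variable e : I -> Z -> C.
Hypothesis e_onb : onb e.
Variables (S : (Z -> C) -> Z -> C) (s : I -> R).
Hypothesis Ss : diag_op e S s.

Lemma app_sandwich M v : app (sandwich S M) v = S (app M (S v)).
Proof.
apply: (onb_ext e_onb) => i; rewrite inner_adjk (app_colop e_onb Ss).
rewrite -(diag_op_selfadjoint e_onb Ss) innerC inner_adjk (app_colop e_onb Ss).
by rewrite -innerC.
Qed.

Lemma hs2_sandwich M : (forall i, `|s i| <= 1) -> hs2 (sandwich S M) <= hs2 M.
Proof.
move=> s1; rewrite hs2_adjk.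
apply: le_trans (hs2_colop e_onb Ss _ ler01 s1) _.
rewrite expr1n mul1r hs2_adjk.
by apply: le_trans (hs2_colop e_onb Ss _ ler01 s1) _; rewrite expr1n mul1r.
Qed.

Lemma sandwichD M N P Q : (forall x y, M x y = N x y + P x y + Q x y) ->
  forall x y, sandwich S M x y = sandwich S N x y + sandwich S P x y + sandwich S Q x y.
Proof.
move=> E x y; rewrite /sandwich /adjk -!rmorphD; congr (_^*).
have E1 x' y' : colop S M x' y' = colop S N x' y' + colop S P x' y' + colop S Q x' y'.
  rewrite (colopD e_onb Ss (N := fun x y => N x y + P x y) (P := Q)) //; congr (_ + _).
  exact: (colopD e_onb Ss).
rewrite (colopD e_onb Ss (N := fun x y => (colop S N y x)^* + (colop S P y x)^*)
  (P := fun x y => (colop S Q y x)^*)); last by move=> x' y'; rewrite E1 !rmorphD.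
by congr (_ + _); exact: (colopD e_onb Ss).
Qed.

Lemma sandwich_tens f : sandwich S (tens f f) = tens (S f) (S f).
Proof.
by rewrite /sandwich (colop_tens e_onb Ss) adjk_tens (colop_tens e_onb Ss) adjk_tens.
Qed.

(** All four copies of [S] move onto [N], so that an l^1 bound is needed only for the coefficients
    of [M] itself, not of its sandwich. *)
Lemma normc_hs_sandwich M N :
  normc (hs (sandwich S M) (sandwich S N)) =
  normc (hs M (colop S (adjk (colop S (colop S (adjk (colop S N))))))).
Proof.
rewrite /sandwich normc_hs_adjkl adjkK (hs_colop e_onb Ss) normc_hs_adjkl.
by rewrite (hs_colop e_onb Ss).
Qed.

End Sandwich.
End Calculus.

(** * Polynomial cutoffs *)

Section Cutoff.
Variable R : realType.
Implicit Types (a b x y kappa : R).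

Lemma bernoulli_sub y m : 0 <= y <= 1 -> 1 - m%:R * y <= (1 - y) ^+ m.
Proof.
move=> /andP[y0 y1]; elim: m => [|m IHm]; first by rewrite mul0r subr0.
rewrite exprS; apply: le_trans (_ : (1 - y) * (1 - m%:R * y) <= _).
  have : 0 <= m%:R * y ^+ 2 by rewrite mulr_ge0 ?ler0n ?sqr_ge0.
  by rewrite -natr1; nra.
by rewrite ler_wpM2l // subr_ge0.
Qed.

Lemma sub_expr_le1 y m : 0 <= y <= 1 -> (1 - y) ^+ m * (1 + m%:R * y) <= 1.
Proof.
move=> /andP[y0 y1]; elim: m => [|m IHm]; first by rewrite mul0r addr0 mulr1.
apply: le_trans IHm; rewrite exprSr -mulrA ler_wpM2l ?exprn_ge0 ?subr_ge0 //.
have : 0 <= m%:R * y ^+ 2 by rewrite mulr_ge0 ?ler0n ?sqr_ge0.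
have : 0 <= y ^+ 2 by rewrite sqr_ge0.
by rewrite -natr1; nra.
Qed.

(** For [x >= 0] this is [sub_expr_le1]. Negative [x] make the left side nonpositive, which is what
    lets [eigenvalue_gt] detect negative eigenvalues. *)
Lemma mul_sub_expr_le x m : (0 < m)%N -> x <= 1 -> x * (1 - x) ^+ m <= m%:R^-1.
Proof.
move=> m0 x1; have m0' : (0 : R) < m%:R by rewrite ltr0n.
have p0 : 0 <= (1 - x) ^+ m by rewrite exprn_ge0 // subr_ge0.
have [x0|/ltW x0] := leP 0 x; last first.
  by apply: le_trans (mulr_le0_ge0 x0 p0) _; rewrite invr_ge0 ltW.
rewrite -[leRHS]mul1r ler_pdivlMr //; apply: le_trans (sub_expr_le1 (y := x) m _).
  by rewrite mulrDr mulr1; nra.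
by rewrite x0.
Qed.

Lemma expr_unbounded x y : 1 < x -> exists n, y <= x ^+ n.
Proof.
move=> x1; have d0 : 0 < x - 1 by rewrite subr_gt0.
have [n yn] : exists n : nat, y / (x - 1) <= n%:R.
  by exists (Num.truncn (y / (x - 1))).+1; rewrite ltW // truncnS_gt.
exists n; move: yn; rewrite ler_pdivrMr // => yn; apply: le_trans yn _.
elim: n => [|n IHn]; first by rewrite mul0r.
rewrite exprS -natr1; have : 1 <= x ^+ n by rewrite exprn_ege1 ?ltW.
nra.
Qed.

(* By Bernoulli's inequality [(1 - x ^ (2 n)) ^ m] is then at least [1 - kappa] on
   [-a, a] and at most [kappa] on [b, 1]. *)
Lemma cutoff_exists a b kappa : 0 < a -> a < b -> b <= 1 -> 0 < kappa -> kappa <= 1 ->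
  exists n m : nat, m%:R * a ^+ (2 * n) <= kappa /\ (1 - b ^+ (2 * n)) ^+ m <= kappa.
Proof.
move=> a0 ab b1 k0 k1; have b0 := lt_trans a0 ab.
have q1 : 1 < (b / a) ^+ 2 by rewrite exprn_egt1 // ltr_pdivlMr // mul1r.
have r1 : 1 < (a ^-1) ^+ 2.
  by rewrite exprn_egt1 // invf_gt1 // (lt_le_trans ab).
(* The first exponent makes [b ^+ (2 * n)] exceed [a ^+ (2 * n)] by the factor [2 / kappa ^+ 2]; the
   second makes [t] below at least 1. *)
have [n1 h1] := expr_unbounded (2 / kappa ^+ 2) q1.
have [n2 h2] := expr_unbounded kappa^-1 r1.
pose n := (n1 + n2)%N.
have {}h1 : 2 / kappa ^+ 2 <= (b / a) ^+ (2 * n).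
  by apply: le_trans h1 _; rewrite exprM ler_weXn2l ?(ltW q1) // leq_addr.
have {}h2 : kappa^-1 <= a^-1 ^+ (2 * n).
  by apply: le_trans h2 _; rewrite exprM ler_weXn2l ?(ltW r1) // leq_addl.
have an0 : 0 < a ^+ (2 * n) by rewrite exprn_gt0.
have bn0 : 0 < b ^+ (2 * n) by rewrite exprn_gt0.
set t := kappa / a ^+ (2 * n).
have t1 : 1 <= t.
  rewrite /t ler_pdivlMr // mul1r -[leRHS]invrK -[leLHS]invrK.
  by rewrite lef_pV2 ?posrE ?invr_gt0 // -exprVn.
(* The largest integer that the first bound allows. As [t >= 1], it is at least [t / 2], so
   [m%:R * b ^+ (2 * n)] is at least [kappa^-1]. *)
pose m := Num.truncn t; exists n, m.
have mt : m%:R <= t by rewrite truncn_le // (le_trans ler01).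
have tm : t < m%:R + 1 by rewrite natr1 truncnS_gt.
have m1 : 1 <= m%:R :> R by rewrite ler1n truncn_gt0.
split; first by rewrite -ler_pdivlMr.
have bn1 : b ^+ (2 * n) <= 1 by rewrite exprn_ile1 // ltW.
have := sub_expr_le1 (y := b ^+ (2 * n)) m.
rewrite (ltW bn0) bn1 => /(_ isT) h.
have p0 : 0 <= (1 - b ^+ (2 * n)) ^+ m by rewrite exprn_ge0 // subr_ge0.
have h3 : kappa^-1 <= m%:R * b ^+ (2 * n).
  apply: le_trans (_ : t / 2 * b ^+ (2 * n) <= _); last first.
    by rewrite ler_pM2r //; lra.
  move: h1; rewrite expr_div_n ler_pdivlMr // => h1.
  have t0 : 0 <= t / 2 by lra.
  apply: le_trans (ler_wpM2l t0 h1).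
  rewrite le_eqVlt; apply/orP; left; apply/eqP; rewrite /t; field.
  by rewrite !gt_eqF.
rewrite -[leRHS]mul1r -[kappa in leRHS]invrK ler_pdivlMr ?invr_gt0 //.
apply: le_trans h; rewrite ler_wpM2l //; lra.
Qed.

End Cutoff.

(** * The regularity decomposition *)

Section Core.
Import ComplexField.Normc.
Variable R : realType.
Local Notation C := (complex R).
Local Notation "x %:C" := (real_complex R x) : ring_scope.
Variable Z : finZmodType.
Local Notation diagonal := Defs.diagonal.
Local Notation K := 'I_#|Z|.
Implicit Types (f g h v w : Z -> C) (M N : Z -> Z -> C).

Definition cut A n m : (Z -> C) -> Z -> C :=
  iter m (fun v x => v x - iter n (app A) v x).

Section EigenBasis.
Variables (A : Z -> Z -> C) (I : finType) (e : I -> Z -> C) (lam : I -> R).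
Hypothesis e_onb : onb e.
Hypothesis hA : hermitian_kernel A.
Hypothesis eA : forall i, app A (e i) =1 (fun x => (lam i)%:C * e i x).

Lemma diag_app : diag_op e (app A) lam.
Proof.
move=> v i; rewrite (hermitian_selfadjoint hA) (eq_inner (frefl v) (eA i)).
by rewrite innerZr conjC_real.
Qed.

Lemma diag_cut n m : diag_op e (cut A n m) (fun i => (1 - lam i ^+ n) ^+ m).
Proof.
apply: (diag_op_iter m) => v i; rewrite innerBl (diag_op_iter n diag_app).
by rewrite rmorphB rmorph1 mulrBl mul1r.
Qed.

Lemma sqn_basis i : sqn (e i) = 1.
Proof. by apply: (@complexI R); rewrite -innerxx e_onb.1 eqxx. Qed.

Lemma eigenvalue_le_hs i (c : R) : 0 <= c -> hs2 A <= c ^+ 2 -> `|lam i| <= c.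
Proof.
move=> c0 Ac; rewrite -ler_sqr ?nnegrE //; apply: le_trans Ac.
have := sqn_app_le A (e i); rewrite sqn_basis mulr1; apply: le_trans.
by rewrite (eq_sqn (eA i)) sqnZ sqn_basis mulr1 normc_real.
Qed.

End EigenBasis.

Lemma iter_lmul A n M y :
  (fun x => iter n (lmul A) M x y) = iter n (app A) (fun x => M x y).
Proof.
elim: n => [//|n IHn]; by rewrite [RHS]iterS -IHn.
Qed.

Lemma colop_cutS A n m M :
  colop (cut A n m.+1) M =
  subk (colop (cut A n m) M) (iter n (lmul A) (colop (cut A n m) M)).
Proof.
apply/funext => x; apply/funext => y; rewrite /subk.
by have /(congr1 (fun g => g x)) /= -> := iter_lmul A n (colop (cut A n m) M) y.
Qed.

Section Sbound.
Variable ch : K -> Z -> C.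
Hypothesis ch_onb : onb ch.
Hypothesis ch_inj : injective ch.
Hypothesis chs : forall chi, dual_group chi <-> exists k, chi = ch k.

(** Left multiplication by [A] costs the l^1 bound [W] of its diagonals, so each factor [1 - A^n]
    costs [1 + W ^+ n]. *)
Lemma sbound_colop_cut A n m M (W c : R) :
  (forall t, \sum_k normc (coef ch A t k) <= W) -> sbound ch M c ->
  sbound ch (colop (cut A n m) M) ((1 + W ^+ n) ^+ m * c).
Proof.
move=> AW Mc; elim: m => [|m IHm]; first by rewrite mul1r.
have lM k M' c' : sbound ch M' c' -> sbound ch (iter k (lmul A) M') (W ^+ k * c').
  move=> h; elim: k => [|k IHk]; first by rewrite mul1r.
  by rewrite exprS -mulrA; exact: sbound_lmul.
rewrite colop_cutS exprS -mulrA mulrDl mul1r.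
by apply: sbound_subk => //; exact: lM.
Qed.

(** Matrix coefficients of Weyl operators move by at most [2 * nu]. Factoring [a^4 - b^4] as
    [(a - b)(a + b)(a^2 + b^2)], with [a + b <= 2] and second moments at most 1, gives the constant
    8. *)
Lemma u3_lipschitz f g (nu : R) : sqn f <= 1 -> sqn g <= 1 -> 0 <= nu ->
  sqn (fun x => f x - g x) <= nu ^+ 2 -> u3 ch f <= u3 ch g + 8 * nu.
Proof.
move=> f1 g1 nu0 fg.
have chD := chD chs.
pose a t k := normc (coef ch (tens f f) t k).
pose b t k := normc (coef ch (tens g g) t k).
have a1 t k : a t k <= 1 by exact: normc_coef_tens_le1.
have b1 t k : b t k <= 1 by exact: normc_coef_tens_le1.
have ab t k : a t k - b t k <= 2 * nu.
  rewrite lerBlDr /a /b !coef_tens.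
  have -> : inner f (weyl ch t k f) =
      inner (fun x => f x - g x) (weyl ch t k f) +
      inner g (weyl ch t k (fun x => f x - g x)) + inner g (weyl ch t k g).
    rewrite innerBl -!addrA -innerDr.
    rewrite [X in _ + (_ + X)](eq_inner (frefl g) (_ : _ =1 weyl ch t k f)).
      by rewrite addNr addr0.
    by move=> x; rewrite /weyl; ring.
  apply: le_trans (le_normcD _ _) _; rewrite lerD2r mulr_natl mulr2n.
  apply: le_trans (le_normcD _ _) _; apply: lerD.
    by rewrite -[leRHS]mulr1; apply: normc_inner_le; rewrite ?ler01 ?expr1n ?sqn_weyl.
  by rewrite -[leRHS]mul1r; apply: normc_inner_le; rewrite ?ler01 ?expr1n ?sqn_weyl.
have a2 : dsum (fun t k => a t k ^+ 2) <= 1 by exact: dsum_coef_tens_le1.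
have b2 : dsum (fun t k => b t k ^+ 2) <= 1 by exact: dsum_coef_tens_le1.
apply: le_trans (_ : dsum (fun t k => b t k ^+ 4 + 4 * nu * (a t k ^+ 2 + b t k ^+ 2)) <= _).
  apply: ler_dsum => t k; rewrite -/(a t k) -lerBlDl.
  have -> : a t k ^+ 4 - b t k ^+ 4 =
    ((a t k - b t k) * (a t k + b t k)) * (a t k ^+ 2 + b t k ^+ 2) by ring.
  apply: ler_wpM2r; first by rewrite addr_ge0 ?sqr_ge0.
  have a0 : 0 <= a t k := normc_ge0 _; have b0 : 0 <= b t k := normc_ge0 _.
  have := ab t k; have := a1 t k; have := b1 t k => h1 h2 h3.
  apply: le_trans (_ : 2 * nu * (a t k + b t k) <= _).
    by rewrite ler_wpM2r // addr_ge0.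
  have : nu * (a t k + b t k) <= nu * 2 by rewrite ler_wpM2l //; lra.
  lra.
rewrite dsumD dsumMl dsumD /u3 lerD2l.
have : nu * (dsum (fun t k => a t k ^+ 2) + dsum (fun t k => b t k ^+ 2)) <= nu * 2.
  by rewrite ler_wpM2l //; lra.
lra.
Qed.

Section Regularity.
Variables (f : Z -> C) (eps eps' delta : R).
Hypothesis f1 : one_bounded f.
Hypothesis eps0 : 0 < eps.
Hypothesis eps1 : eps <= 1.
Hypothesis eps'0 : 0 < eps'.
Let N := tensor_conj f.
Let A := denoise_mx eps N.
Let E := subk (denoise_mx eps' N) A.
Let B := subk N (denoise_mx eps' N).
Hypothesis delta0 : 0 <= delta.
Hypothesis Edelta : hs2 E <= delta ^+ 2.
Variables (e : K -> Z -> C) (lam : K -> R).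
Hypothesis e_onb : onb e.
Hypothesis eA : forall i, app A (e i) =1 (fun x => (lam i)%:C * e i x).

Lemma sqn_f_le1 : sqn f <= 1.
Proof.
apply: le_trans (_ : avgr (fun _ : Z => 1) <= _); last by rewrite avgr_cst.
apply: ler_avgr => z; rewrite exprn_ile1 ?normc_ge0 //.
by rewrite -lecR normcE_norm rmorph1 f1.
Qed.

Lemma regularity_decomposition x y : N x y = A x y + E x y + B x y.
Proof. by rewrite /E /B /subk; ring. Qed.

Let hA : hermitian_kernel A := hermitian_denoise ch_inj chs eps f.

Lemma hs2_A_le1 : hs2 A <= 1.
Proof.
apply: le_trans (hs2_denoise_le ch_onb ch_inj chs _ eps0) _.
by rewrite (hs2_tens f f) mulr_ile1 ?sqn_ge0 ?sqn_f_le1.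
Qed.

Lemma eigenvalue_le1 i : `|lam i| <= 1.
Proof. by apply: (eigenvalue_le_hs e_onb eA) => //; rewrite expr1n hs2_A_le1. Qed.

Lemma sum_coef_A t : \sum_k normc (coef ch A t k) <= eps^-1.
Proof. exact: sum_coef_denoise. Qed.

Lemma sboundB : sbound ch B eps'.
Proof. exact: sbound_denoise. Qed.

(* Testing the decomposition against [A (1 - A) ^ (2 k)]: the negative
   eigenvalues contribute positively to the Hilbert-Schmidt norm but negatively
   to the quadratic form at [f]. *)
Lemma eigenvalue_gt k (sigma : R) : (0 < k)%N -> 0 < sigma ->
  (2 * k)%:R^-1 + 4 ^+ k * delta + eps^-1 * ((1 + eps^-1) ^+ (2 * k) * eps') < sigma ^+ 2 ->
  forall i, - sigma < lam i.
Proof.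
move=> k0 sg0 hs i; rewrite ltNge; apply/negP => li; move: hs; apply/negP; rewrite -leNgt.
pose S := cut A 1 k.
have Ss : diag_op e S (fun i => (1 - lam i ^+ 1) ^+ k) by exact: diag_cut.
pose P := colop S (colop S A).
have s2 j : `|(1 - lam j ^+ 1) ^+ k| <= 2 ^+ k.
  rewrite normrX lerXn2r ?nnegrE ?normr_ge0 ?ler0n // expr1.
  by have := eigenvalue_le1 j; rewrite !ler_norml => /andP[? ?]; lra.
have PA : hs P A = (hs2 (colop S A))%:C.
  by rewrite (hs_colop e_onb Ss) hsxx.
(* An eigenvalue at most [- sigma] shows on its own eigenvector: there [1 - lam i >= 1], so [S] does
   not shrink it. *)
have hS : sigma ^+ 2 <= hs2 (colop S A).
  have := sqn_app_le (colop S A) (e i); rewrite (sqn_basis e_onb) mulr1; apply: le_trans.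
  rewrite (app_colop e_onb Ss) (sqn_diag_op e_onb Ss) (bigD1 i) //=.
  rewrite (eq_inner (eA i) (frefl _)) innerZl e_onb.1 eqxx mulr1 normc_real.
  apply: ler_wpDr.
    by apply: sumr_ge0 => j _; rewrite mulr_ge0 ?sqr_ge0.
  rewrite real_normK ?num_real // expr1 -exprM.
  have l1 : 1 <= (1 - lam i) ^+ (k * 2) by rewrite exprn_ege1 //; lra.
  have l2 : sigma ^+ 2 <= lam i ^+ 2 by nra.
  by apply: le_trans l2 _; rewrite ler_peMl ?sqr_ge0.
have PN : complex.Re (hs P N) <= (2 * k)%:R^-1.
  rewrite -[N]/(tens f f) -inner_app_hs /P !(app_colop e_onb Ss).
  rewrite (Re_diag_op e_onb (diag_op_comp Ss (diag_op_comp Ss (diag_app hA eA)))).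
  apply: le_trans (_ : \sum_i (2 * k)%:R^-1 * normc (inner f (e i)) ^+ 2 <= _).
    apply: ler_sum => j _; apply: ler_wpM2r; first exact: sqr_ge0.
    rewrite mulrA -exprD addnn -mul2n mulrC expr1; apply: mul_sub_expr_le.
      by rewrite muln_gt0.
    by have := eigenvalue_le1 j; rewrite ler_norml => /andP[].
  rewrite -mulr_sumr -(parseval_sqn _ e_onb) ler_piMr ?sqn_f_le1 //.
have PE : normc (hs P E) <= 4 ^+ k * delta.
  rewrite -ler_sqr ?nnegrE ?normc_ge0 ?mulr_ge0 ?exprn_ge0 ?ler0n //.
  apply: le_trans (hs_cs ch_onb _ _) _; rewrite exprMn; apply: ler_pM; rewrite ?hs2_ge0 //.
  apply: le_trans (hs2_colop e_onb Ss _ _ s2) _; first by rewrite exprn_ge0 ?ler0n.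
  have -> : (4 ^+ k) ^+ 2 = (2 ^+ k) ^+ 2 * ((2 ^+ k) ^+ 2 * 1) :> R.
    by rewrite mulr1 -!exprMn; congr (_ ^+ _ ^+ _); ring.
  rewrite ler_wpM2l ?sqr_ge0 //.
  apply: le_trans (hs2_colop e_onb Ss _ _ s2) _; first by rewrite exprn_ge0 ?ler0n.
  by rewrite ler_wpM2l ?sqr_ge0 ?hs2_A_le1.
(* Both copies of [S] go onto [B]; the l^1 bound for [A] then meets the uniform bound for the
   result. *)
have PB : normc (hs P B) <= eps^-1 * ((1 + eps^-1) ^+ (2 * k) * eps').
  rewrite !(hs_colop e_onb Ss).
  have ei : 0 < eps^-1 by rewrite invr_gt0.
  apply: (normc_hs_sbound ch_onb sum_coef_A).
    by rewrite mulr_ge0 ?(ltW eps'0) // exprn_ge0 // addr_ge0 // ltW.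
  have -> : (1 + eps^-1) ^+ (2 * k) * eps' =
     (1 + eps^-1 ^+ 1) ^+ k * ((1 + eps^-1 ^+ 1) ^+ k * eps').
    by rewrite expr1 mulrA -exprD addnn mul2n.
  apply: (sbound_colop_cut _ _ sum_coef_A); apply: (sbound_colop_cut _ _ sum_coef_A).
  exact: sboundB.
have hD : hs P N = hs P A + hs P E + hs P B.
  rewrite /hs -!avgD; apply: eq_avg => x; rewrite -!avgD; apply: eq_avg => y.
  by rewrite regularity_decomposition !rmorphD /=; ring.
have := normr_Re_le (hs P E); have := normr_Re_le (hs P B).
move: PN; rewrite hD PA !raddfD /= !ler_norml => q1 /andP[b1 b2] /andP[b3 b4].
lra.
Qed.

Definition freg (b : R) : Z -> C :=
  fun x => \sum_(i | b <= lam i) inner f (e i) * e i x.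

Lemma inner_freg b i : inner (freg b) (e i) = if b <= lam i then inner f (e i) else 0.
Proof.
rewrite inner_suml; case: ifP => bi.
  rewrite (bigD1 i) //= big1 ?addr0; first by rewrite innerZl e_onb.1 eqxx mulr1.
  by move=> j /andP[_ ji]; rewrite innerZl e_onb.1 (negbTE ji) mulr0.
rewrite big1 // => j bj; rewrite innerZl e_onb.1.
by case: eqVneq bj bi => [->|_ _ _]; [move=> -> | rewrite mulr0].
Qed.

(** The cutoff [T] is near 1 on eigenvalues below [a] and near 0 on those from [b] on, and [f] has
    mass at most [mu] between, so [T f] is within [b ^+ 3] of [f - freg b] in L^2. Sandwiching the
    decomposition between copies of [T] leaves a structured part with spectrum in [[- sigma, b]], to
    which the self-improving estimate applies. *)
Lemma u3_sub_freg (a b kappa mu sigma : R) (n m : nat)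
    (theta := eps^-1 * ((1 + eps^-1 ^+ (2 * n)) ^+ (4 * m) * eps')) :
  0 < a -> a < b -> b <= 1 -> 0 <= kappa -> kappa <= b ->
  m%:R * a ^+ (2 * n) <= kappa -> (1 - b ^+ (2 * n)) ^+ m <= kappa ->
  \sum_(i | a <= lam i < b) normc (inner f (e i)) ^+ 2 <= mu ->
  kappa ^+ 2 + mu <= b ^+ 6 -> (forall i, - sigma < lam i) -> 0 <= sigma -> sigma <= a ->
  4 * delta + 4 * theta + 2 * sigma <= b ^+ 6 -> delta + theta <= b ->
  u3 ch (fun x => f x - freg b x) <= 256 * b ^+ 3.
Proof.
move=> a0 ab b1 ka0 kab ma bm fmu kmu lamg sg0 sga bnd1 bnd2.
have b0 : 0 < b by exact: lt_trans ab.
have chD := chD chs.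
have ei1 : 1 <= eps^-1 by rewrite invf_ge1.
pose P := (1 + eps^-1 ^+ (2 * n)) ^+ m.
have P1 : 1 <= P by rewrite exprn_ege1 // lerDl exprn_ge0 // (le_trans ler01).
have P0 : 0 <= P by rewrite (le_trans ler01).
(* One factor [P] for each of the four copies of [T] that move onto [B] when the sandwiches of [A]
   and [B] are paired. *)
have thetaE : theta = eps^-1 * (P * (P * (P * (P * eps')))).
  by rewrite /theta [(4 * m)%N]mulnC exprM -/P; ring.
pose p i := (1 - lam i ^+ (2 * n)) ^+ m.
pose T := cut A (2 * n) m.
have Tp : diag_op e T p by exact: diag_cut.
have l1 i : 0 <= lam i ^+ (2 * n) <= 1.
  rewrite exprM; have /ler_normlP[h1 h2] := eigenvalue_le1 i.
  by rewrite exprn_ge0 ?sqr_ge0 //= exprn_ile1 ?sqr_ge0 //; nra.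
have p01 i : 0 <= p i <= 1.
  have /andP[h1 h2] := l1 i.
  by rewrite exprn_ge0 ?subr_ge0 //= exprn_ile1 ?subr_ge0 // gerBl.
have pn i : `|p i| <= 1 by have /andP[h1 h2] := p01 i; rewrite ger0_norm.
have p_small i : lam i < a -> 1 - p i <= kappa.
  move=> la; have := bernoulli_sub m (l1 i); rewrite -/(p i) => h.
  apply: le_trans ma; apply: le_trans (_ : m%:R * lam i ^+ (2 * n) <= _); first by lra.
  rewrite ler_wpM2l ?ler0n // !exprM lerXn2r ?nnegrE ?sqr_ge0 //.
  have := lamg i; nra.
have p_big i : b <= lam i -> p i <= kappa.
  move=> bl; apply: le_trans bm; have /andP[h1 h2] := l1 i.
  rewrite lerXn2r ?nnegrE ?subr_ge0 //.
    by apply: le_trans h2; rewrite lerXn2r ?nnegrE // ?(ltW b0) // (le_trans (ltW b0)).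
  by rewrite lerD2l lerN2 lerXn2r ?nnegrE // ?(ltW b0) // (le_trans (ltW b0)).
have hTf : sqn (T f) <= 1.
  apply: le_trans (sqn_diag_op_le e_onb Tp f ler01 pn) _.
  by rewrite expr1n mul1r sqn_f_le1.
pose fr x := f x - freg b x.
have fr_e i : inner fr (e i) = (if lam i < b then inner f (e i) else 0).
  rewrite innerBl inner_freg; case: leP => _; first by rewrite subrr.
  by rewrite subr0.
have hfr : sqn fr <= 1.
  apply: le_trans sqn_f_le1; rewrite !(parseval_sqn _ e_onb); apply: ler_sum => i _.
  by rewrite fr_e; case: ifP => // _; rewrite normc0 expr0n sqr_ge0.
have dist : sqn (fun x => fr x - T f x) <= (b ^+ 3) ^+ 2.
  rewrite -exprM; apply: le_trans kmu; rewrite (parseval_sqn _ e_onb).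
  apply: le_trans (_ : \sum_i (kappa ^+ 2 * normc (inner f (e i)) ^+ 2 +
     (if a <= lam i < b then normc (inner f (e i)) ^+ 2 else 0)) <= _); last first.
    rewrite big_split /= -mulr_sumr -(parseval_sqn _ e_onb) -big_mkcond /=.
    by apply: lerD => //; rewrite ler_piMr ?sqr_ge0 ?sqn_f_le1.
  apply: ler_sum => i _; rewrite innerBl fr_e Tp.
  move: (inner f (e i)) => c; have c2 : 0 <= normc c ^+ 2 by rewrite sqr_ge0.
  have /andP[h1 h2] := p01 i.
  have [lb|lb] := ltP (lam i) b; last first.
    rewrite andbF addr0 sub0r normcN normcM normc_real exprMn ler_wpM2r //.
    by rewrite real_normK ?num_real // lerXn2r ?nnegrE // p_big.
  have -> : c - (p i)%:C * c = (1 - p i)%:C * c by rewrite rmorphB rmorph1 mulrBl mul1r.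
  rewrite normcM normc_real exprMn real_normK ?num_real //.
  have [la|la] := leP a (lam i); last first.
    by rewrite /= addr0 ler_wpM2r // lerXn2r ?nnegrE ?subr_ge0 // p_small.
  rewrite /= -[leLHS]add0r; apply: lerD; first by rewrite mulr_ge0 ?sqr_ge0.
  by rewrite ler_piMl // exprn_ile1 ?subr_ge0 // gerBl.
have hlip := u3_lipschitz hfr hTf (exprn_ge0 3 (ltW b0)) dist.
apply: le_trans hlip _.
(* Replacing [f - freg b] by [T f] costs [8 * b ^+ 3], so 16 leaves ample room below 256. *)
suff hX : u3 ch (T f) <= 16 * b ^+ 3.
  have : 0 <= b ^+ 3 by rewrite exprn_ge0 // ltW.
  by move: hX; move: (u3 _ _) (b ^+ 3) => X y; lra.
pose A' := sandwich T A; pose E' := sandwich T E; pose B' := sandwich T B.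
have th0 : 0 <= theta.
  by rewrite thetaE !mulr_ge0 // ?(ltW eps'0) // (le_trans ler01).
have fE x y : tens (T f) (T f) x y = A' x y + E' x y + B' x y.
  rewrite -(sandwich_tens e_onb Tp f).
  exact: (sandwichD e_onb Tp regularity_decomposition).
have appA' v : app A' v = T (app A (T v)) by exact: (app_sandwich e_onb Tp).
have dA' : diag_op e (app A') (fun i => p i * (lam i * p i)).
  move=> v i; rewrite appA'.
  exact: (diag_op_comp Tp (diag_op_comp (diag_app hA eA) Tp)).
have sA' : selfadjoint (app A') := diag_op_selfadjoint e_onb dA'.
have A'1 : hs2 A' <= 1 by apply: le_trans (hs2_sandwich e_onb Tp _ pn) hs2_A_le1.
have E'd : hs2 E' <= delta ^+ 2 by apply: le_trans (hs2_sandwich e_onb Tp _ pn) Edelta.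
have sT M c : sbound ch M c -> sbound ch (colop T M) (P * c).
  by move=> h; apply: sbound_colop_cut => //; exact: sum_coef_A.
have B's : sbound ch B' theta.
  have h : sbound ch B' (P * (P * eps')).
    apply: (sbound_adjk chs); apply: (sT _ _); apply: (sbound_adjk chs).
    by apply: (sT _ _); exact: sboundB.
  move=> t k; apply: le_trans (h t k) _; rewrite thetaE.
  have h1 : P * (P * eps') <= P * (P * (P * (P * eps'))).
    have e0 := ltW eps'0.
    do 2 (rewrite ler_wpM2l //); rewrite -[leLHS]mul1r mulrA ler_wpM2r //.
    by rewrite mulr_ege1.
  apply: le_trans h1 _; rewrite ler_peMl // !mulr_ge0 // ltW //.
have hth : normc (hs A' B') <= theta.
  rewrite (normc_hs_sandwich e_onb Tp) thetaE.
  apply: (normc_hs_sbound ch_onb sum_coef_A); first by rewrite !mulr_ge0 // ltW.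
  apply: (sT _ _); apply: (sbound_adjk chs); apply: (sT _ _); apply: (sT _ _).
  apply: (sbound_adjk chs).
  by apply: (sT _ _); exact: sboundB.
have x_le i : p i * (lam i * p i) <= b.
  have /andP[h1 h2] := p01 i; have /ler_normlP[_ h3] := eigenvalue_le1 i.
  have [bl|bl] := leP b (lam i).
    apply: le_trans (_ : p i * 1 <= _); last by rewrite mulr1 (le_trans (p_big _ bl)).
    by rewrite ler_wpM2l // mulr_ile1 // (le_trans (ltW b0)).
  have [l0|l0] := leP 0 (lam i).
    have h4 : lam i * p i <= lam i by rewrite ler_piMr.
    apply: le_trans (ltW bl); apply: le_trans h4; rewrite ler_piMl //; exact: mulr_ge0.
  apply: le_trans (ltW b0); rewrite mulr_ge0_le0 //; rewrite mulr_le0_ge0 // ltW //.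
have x_ge i : - sigma <= p i * (lam i * p i).
  have /andP[h1 h2] := p01 i; have h3 := lamg i.
  have [l0|l0] := leP 0 (lam i).
    by apply: le_trans (_ : 0 <= _); [rewrite oppr_le0 | rewrite !mulr_ge0].
  apply: le_trans (ltW h3) _; have : p i * p i <= 1 by rewrite mulr_ile1.
  have : 0 <= p i * p i by rewrite mulr_ge0.
  nra.
have qA' w : complex.Re (quad A' w) <= b * sqn w.
  rewrite (Re_diag_op e_onb dA') (parseval_sqn w e_onb) mulr_sumr.
  by apply: ler_sum => i _; rewrite ler_wpM2r ?sqr_ge0.
(* For [x] in [[- sigma, b]], nonnegativity of [(x + sigma) * (b - x)] yields
   [x ^+ 2 <= b * x + 2 * sigma]. *)
have nA' w : sqn (app A' w) <= b * complex.Re (quad A' w) + (2 * sigma) * sqn w.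
  rewrite (Re_diag_op e_onb dA') (sqn_diag_op e_onb dA') (parseval_sqn w e_onb).
  rewrite !mulr_sumr -big_split /=; apply: ler_sum => i _.
  rewrite mulrA -mulrDl ler_wpM2r ?sqr_ge0 //.
  have := x_le i; have := x_ge i; move: (p i * _) => x h1 h2.
  have h3 : 0 <= (x + sigma) * (b - x) by rewrite mulr_ge0 ?subr_ge0 //; lra.
  have h4 : sigma * b <= sigma * 1 by rewrite ler_wpM2l.
  have h5 : sigma * (- x) <= sigma * 1 by rewrite ler_wpM2l //; lra.
  nra.
have [W hXW hW] := u3_le_sqrt ch_onb chD hTf fE delta0 E'd th0 B's.
have hY := hs2_structured_le ch_onb hTf fE A'1 delta0 E'd hth (ltW b0) qA'.
have s20 : 0 <= 2 * sigma by rewrite mulr_ge0.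
have hZ :=
  dsum_V6_le ch_onb chD hTf fE sA' A'1 delta0 E'd th0 B's (ltW b0) b1 s20 qA' nA'.
move: hXW hW hY hZ; set X := u3 ch (T f).
have X0 : 0 <= X by exact: u3_ge0.
set Y := hs2 A'; set V6 := dsum _ => hXW hW hY hZ.
have Y0 : 0 <= Y by exact: hs2_ge0.
have V60 : 0 <= V6 by apply: dsum_ge0 => t k; rewrite exprn_ge0 ?normc_ge0.
have b6 : b ^+ 6 <= b ^+ 3 by apply: ler_wiXn2l => //; exact: ltW.
have b30 : 0 < b ^+ 3 by rewrite exprn_gt0.
(* If [X > 16 * b ^+ 3], the errors are absorbed into [X / 16], and the three estimates combine to a
   quadratic inequality in [X] and [b ^+ 3] that is then impossible. *)
rewrite leNgt; apply/negP => hX.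
have hY2 : Y <= 2 * b by lra.
have hZ2 : V6 <= b ^+ 2 * X + b ^+ 6 by lra.
have hW2 : W ^+ 2 <= 2 * b * (b ^+ 2 * X + b ^+ 6).
  by apply: le_trans hW _; apply: ler_pM.
have hW1 : 15 / 16 * X <= W by lra.
have hW3 : (15 / 16 * X) ^+ 2 <= W ^+ 2.
  by rewrite lerXn2r ?nnegrE //; [rewrite mulr_ge0 | apply: le_trans hW1; rewrite mulr_ge0].
have E1 : 2 * b * (b ^+ 2 * X + b ^+ 6) = 2 * b ^+ 3 * X + 2 * b * (b ^+ 3) ^+ 2 by ring.
have h7 : 2 * b * (b ^+ 3) ^+ 2 <= 2 * (b ^+ 3) ^+ 2.
  by rewrite ler_wpM2r ?sqr_ge0 //; lra.
move: hW2 hX; rewrite E1; move: (b ^+ 3) b30 h7 => y y0 h7 hW2 hX.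
have h8 : (15 / 16 * X) ^+ 2 <= 2 * y * X + 2 * y ^+ 2 by lra.
nra.
Qed.

End Regularity.
End Sbound.
End Core.

(** * Choice of the parameters *)

Section Final.
Import ComplexField.Normc.
Variable R : realType.
Local Notation C := (complex R).
Local Notation "x %:C" := (real_complex R x) : ring_scope.

(** * The spectral projection and its preimage under the structured operator *)

Section Projection.
Variable Z : finZmodType.
Local Notation K := 'I_#|Z|.
Variables (A : Z -> Z -> C) (f : Z -> C) (e : K -> Z -> C) (lam : K -> R).
Hypothesis e_onb : onb e.
Hypothesis hA : hermitian_kernel A.
Hypothesis eA : forall i, app A (e i) =1 (fun x => (lam i)%:C * e i x).

(** By self-adjointness, an eigenvector for [mu >= b] is orthogonal to every [e i] with [lam i < b],
    and only those [e i] occur in [f - freg]. *)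
Lemma freg_projection b :
  is_orthogonal_projection (spectral_space A b) f (freg f e lam b).
Proof.
split.
  (* To index by the whole basis, discarded vectors are replaced by 0, which lies in the eigenspace
     for [b]. *)
  exists #|Z|, (fun i => if b <= lam i then inner f (e i) else 0),
    (fun i => if b <= lam i then e i else fun=> 0); split=> [i|x].
    case: ifP => bi.
      by exists (lam i) => //= x; exact: eA.
    by exists b => //= x; rewrite mulr0 /avg big1 ?mulr0 // => y _; rewrite mulr0.
  by rewrite /freg big_mkcond; apply: eq_bigr => i _; case: ifP => // _; rewrite mul0r.
move=> v [n [c [w [wS vE]]]].
rewrite (eq_inner (frefl _) vE) inner_sumr big1 // => j _.
rewrite innerZr; have [mu /= bmu wmu] := wS j.
rewrite (parseval _ _ e_onb) big1 ?mulr0 // => i _.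
rewrite innerBl (inner_freg _ _ e_onb); case: ifP => bi; first by rewrite subrr mul0r.
have : inner (app A (w j)) (e i) = mu%:C * inner (w j) (e i).
  by rewrite -innerZl; apply: eq_inner.
rewrite (diag_app hA eA).
have [->|nz] := eqVneq (inner (w j) (e i)) 0; first by rewrite conjC0 !mulr0.
move=> /(mulIf nz)/complexI E.
by rewrite E bmu in bi.
Qed.

(** Dividing coefficients by eigenvalues inverts [A] on the retained eigenspaces, where
    [lam i >= b]. *)
Lemma freg_app b : 0 < b ->
  exists2 w : Z -> C, freg f e lam b =1 app A w & sqn w <= b^-1 ^+ 2 * sqn f.
Proof.
move=> b0; pose w : Z -> C := fun x =>
  \sum_(i | b <= lam i) ((lam i)^-1)%:C * inner f (e i) * e i x.
have wE i : inner w (e i) = (if b <= lam i then ((lam i)^-1)%:C * inner f (e i) else 0).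
  rewrite inner_suml; case: ifP => bi.
    rewrite (bigD1 i) //= big1 ?addr0; first by rewrite innerZl e_onb.1 eqxx mulr1.
    by move=> j /andP[_ ji]; rewrite innerZl e_onb.1 (negbTE ji) mulr0.
  rewrite big1 // => j bj; rewrite innerZl e_onb.1.
  by case: eqVneq bj bi => [->|_ _ _]; [move=> -> | rewrite mulr0].
exists w.
  suff -> : freg f e lam b = app A w by [].
  apply: (onb_ext e_onb) => i; rewrite (inner_freg _ _ e_onb) (diag_app hA eA) wE.
  case: ifP => bi; last by rewrite mulr0.
  by rewrite mulrA -rmorphM mulfV ?rmorph1 ?mul1r // gt_eqF // (lt_le_trans b0).
rewrite !(parseval_sqn _ e_onb) mulr_sumr; apply: ler_sum => i _; rewrite wE.
case: ifP => bi; last by rewrite normc0 expr0n mulr_ge0 ?sqr_ge0.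
have l0 : 0 < lam i by rewrite (lt_le_trans b0).
rewrite normcM normc_real exprMn ler_wpM2r ?sqr_ge0 // real_normK ?num_real //.
by rewrite lerXn2r ?nnegrE ?invr_ge0 ?(ltW b0) ?(ltW l0) // lef_pV2.
Qed.

End Projection.

Lemma gowers3_le1 (Z : finZmodType) (ch : 'I_#|Z| -> Z -> C) (g : Z -> C) :
  onb ch -> (forall k, dual_group (ch k)) -> gowers_norm 3 g <= 1 -> u3 ch g <= 1.
Proof.
move=> co cD; rewrite (gowers3E g co cD) => h.
have u0 := u3_ge0 ch g.
have -> : u3 ch g = (u3 ch g `^ 8^-1) ^+ 8.
  by rewrite -powR_mulrn ?powR_ge0 // -powRrM mulVf ?pnatr_eq0 // powRr1.
by rewrite exprn_ile1 ?powR_ge0.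
Qed.

(** The increments telescope to at most 1, so they cannot all exceed [n%:R^-1]. *)
Lemma pigeonhole (u : nat -> R) n : (0 < n)%N -> 0 <= u 0%N -> u n <= 1 ->
  exists j : 'I_n, u j.+1 - u j <= n%:R^-1.
Proof.
move=> n0 u0 un; apply: contrapT => h.
have h' (j : 'I_n) : n%:R^-1 < u j.+1 - u j.
  by rewrite ltNge; apply/negP => ?; apply: h; exists j.
have : \sum_(j < n) n%:R^-1 < \sum_(j < n) (u j.+1 - u j).
  apply: ltr_sum => [|j _]; last exact: h'.
  by apply/hasP; exists (Ordinal n0); rewrite ?mem_index_enum.
rewrite sumr_const card_ord -[_ *+ n]mulr_natr mulVf ?pnatr_eq0 -?lt0n //.
rewrite -(big_mkord xpredT (fun j => u j.+1 - u j)) telescope_sumr // ltrBrDr.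
by move/lt_le_trans => /(_ _ un); rewrite gtrDl ltNge u0.
Qed.

Lemma exists_invn_le (x : R) : 0 < x -> exists2 n : nat, (0 < n)%N & n%:R^-1 <= x.
Proof.
move=> x0; exists (Num.truncn x^-1).+1 => //.
by rewrite -[leRHS]invrK lef_pV2 ?posrE ?invr_gt0 ?ltr0n // ltW // truncnS_gt.
Qed.

(** * The rapidly decreasing sequence of thresholds *)

Section Sequence.
Variables (J : finType) (n m : J -> nat) (k : nat) (xi : R).
Hypothesis xi0 : 0 < xi.
Hypothesis xi1 : xi <= 1.

(* Small enough to absorb the loss of [sbound_colop_cut] for every window [j]. *)
Definition next_eps (x : R) : R :=
  xi / (x^-1 * (\sum_j (1 + x^-1 ^+ (2 * n j)) ^+ (4 * m j) + (1 + x^-1) ^+ (2 * k))).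

Lemma next_epsP x : 0 < x -> x <= 1 ->
  [/\ 0 < next_eps x, next_eps x <= x,
    forall j, x^-1 * ((1 + x^-1 ^+ (2 * n j)) ^+ (4 * m j) * next_eps x) <= xi &
    x^-1 * ((1 + x^-1) ^+ (2 * k) * next_eps x) <= xi].
Proof.
move=> x0 x1; have xV0 : 0 < x^-1 by rewrite invr_gt0.
have t0 j : 0 <= (1 + x^-1 ^+ (2 * n j)) ^+ (4 * m j).
  by rewrite exprn_ge0 // addr_ge0 // exprn_ge0 // ltW.
have s0 : 0 <= \sum_j (1 + x^-1 ^+ (2 * n j)) ^+ (4 * m j) by rewrite sumr_ge0.
have p1 : 1 <= (1 + x^-1) ^+ (2 * k) by rewrite exprn_ege1 // lerDl ltW.
rewrite /next_eps; set s := \sum_j _ in s0 *; set p := _ ^+ (2 * k) in p1 *.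
have sp : 0 < s + p by rewrite ltr_wpDl // (lt_le_trans ltr01).
have main y : y <= s + p -> x^-1 * (y * (xi / (x^-1 * (s + p)))) <= xi.
  move=> ysp; have -> : x^-1 * (y * (xi / (x^-1 * (s + p)))) = xi * (y / (s + p)).
    by field; rewrite !gt_eqF.
  by rewrite ler_piMr ?(ltW xi0) // ler_pdivrMr // mul1r.
split.
- by rewrite divr_gt0 // mulr_gt0.
- rewrite ler_pdivrMr ?mulr_gt0 // mulrA mulfV ?gt_eqF // mul1r.
  by apply: le_trans xi1 _; rewrite (le_trans p1) // lerDr.
- move=> j; apply: main; rewrite /s (bigD1 j) //= -addrA lerDl addr_ge0 //.
    by rewrite sumr_ge0.
  by rewrite (le_trans ler01).
- by apply: main; rewrite lerDr.
Qed.

Definition eps_seq i : R := iter i next_eps 1.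

Lemma eps_seqP i : 0 < eps_seq i /\ eps_seq i <= 1.
Proof.
elim: i => [|i [h0 h1]]; first by rewrite ltr01.
have [a b _ _] := next_epsP h0 h1; split=> //; exact: le_trans b h1.
Qed.

Lemma eps_seq_nonincreasing i j : (i <= j)%N -> eps_seq j <= eps_seq i.
Proof.
elim: j => [|j IHj]; first by rewrite leqn0 => /eqP ->.
rewrite leq_eqVlt => /orP[/eqP -> //|/IHj]; apply: le_trans.
by have [h0 h1] := eps_seqP j; have [] := next_epsP h0 h1.
Qed.

End Sequence.

(** The spectral windows and their cutoffs are fixed first, then [k], [delta], [xi] and the
    thresholds; only afterwards do [Z] and [f] appear, so [eps0] depends on [lo] and [hi] alone. The
    right spectral window is known only once [A] is, so the thresholds must decrease fast enough for
    all windows at once. *)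
Lemma regularity (lo hi : R) : 0 < lo -> lo < hi -> hi < 1 ->
  exists2 eps0 : R, 0 < eps0 &
  forall (Z : finZmodType) (f : Z -> C), one_bounded f ->
  exists rho eps : R, [/\ lo <= rho <= hi, eps0 <= eps <= 1 &
  exists fr : Z -> C,
  [/\ is_orthogonal_projection
        (spectral_space (denoise_mx eps (tensor_conj f)) rho) f fr,
      gowers_norm 3 (f \- fr) <= 2 * (rho `^ (3 / 8)) &
      (gowers_dual_norm 3 fr <= (eps0^-1 * lo^-1)%:E)%E]].
Proof.
move=> lo0 lohi hi1; have hi0 := lt_trans lo0 lohi.
have lo1 : lo <= 1 by rewrite ltW // (lt_trans lohi).
have l6 : 0 < lo ^+ 6 by rewrite exprn_gt0.
have l61 : lo ^+ 6 <= lo by rewrite -[leRHS]expr1; apply: ler_wiXn2l => //; exact: ltW.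
pose kappa := lo ^+ 6 / 2.
pose sigma := lo ^+ 6 / 8.
have sg0 : 0 < sigma by rewrite /sigma; lra.
have l62 : 0 < lo ^+ 6 / 2 by lra.
(* Enough windows that one of them carries mass at most [lo ^+ 6 / 2] of [f]. *)
have [n n0 nmass] := exists_invn_le l62.
pose a (j : nat) := lo + (hi - lo) * (j%:R / n%:R).
have nR0 : (0 : R) < n%:R by rewrite ltr0n.
have aS j : a j < a j.+1.
  by rewrite /a ltrD2l ltr_pM2l ?subr_gt0 // ltr_pM2r ?invr_gt0 // ltr_nat.
have a_lo j : lo <= a j.
  by rewrite lerDl mulr_ge0 ?subr_ge0 ?(ltW lohi) // divr_ge0 ?ler0n.
have a_hi j : (j <= n)%N -> a j <= hi.
  move=> jn; rewrite /a -lerBrDl ler_piMr ?subr_ge0 ?(ltW lohi) //.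
  by rewrite ler_pdivrMr // mul1r ler_nat.
have [N hN] : exists N : 'I_n -> nat * nat, forall j : 'I_n,
    (N j).2%:R * a j ^+ (2 * (N j).1) <= kappa /\
    (1 - a j.+1 ^+ (2 * (N j).1)) ^+ (N j).2 <= kappa.
  have h (j : 'I_n) : exists nm : nat * nat,
      nm.2%:R * a j ^+ (2 * nm.1) <= kappa /\
      (1 - a j.+1 ^+ (2 * nm.1)) ^+ nm.2 <= kappa.
    have [| | | | |n' [m' h]] := @cutoff_exists R (a j) (a j.+1) kappa.
    - exact: lt_le_trans (a_lo j).
    - exact: aS.
    - by rewrite (le_trans (a_hi _ (ltn_ord j))) // ltW.
    - by rewrite /kappa; lra.
    - by rewrite /kappa; lra.
    by exists (n', m').
  by have [N hN] := choice h; exists N.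
(* Each of the three terms in [eigenvalue_gt] is to be at most [sigma ^+ 2 / 4]. *)
have s24 : 0 < sigma ^+ 2 / 4 by rewrite divr_gt0 ?exprn_gt0.
have [k k0 hk] := exists_invn_le s24.
pose delta := Num.min (lo ^+ 6 / 16) (sigma ^+ 2 / 4 / 4 ^+ k).
have p4 : (0 : R) < 4 ^+ k by rewrite exprn_gt0.
have delta0 : 0 < delta by rewrite lt_min divr_gt0 //= divr_gt0.
have delta1 : delta <= lo ^+ 6 / 16 by rewrite ge_min lexx.
have delta2 : 4 ^+ k * delta <= sigma ^+ 2 / 4.
  by rewrite mulrC -ler_pdivlMr // ge_min lexx orbT.
pose xi := Num.min (lo ^+ 6 / 16) (sigma ^+ 2 / 4).
have xi0 : 0 < xi by rewrite lt_min s24 andbT; lra.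
have xiA : xi <= lo ^+ 6 / 16 by rewrite ge_min lexx.
have xiB : xi <= sigma ^+ 2 / 4 by rewrite ge_min lexx orbT.
have xi1 : xi <= 1 by lra.
(* The squared Hilbert-Schmidt norms stay in [[0, 1]], so among [L] consecutive increments one is at
   most [delta ^+ 2]. *)
have [L L0 hL] := exists_invn_le (exprn_gt0 2 delta0).
pose es := eps_seq (fun j => (N j).1) (fun j => (N j).2) k xi.
have esP i : 0 < es i /\ es i <= 1 by exact: eps_seqP.
exists (es L); first by have [] := esP L.
move=> Z f f1.
have [ch ch_onb [ch_inj chs]] := dual_group_onb R Z.
have chD := chD chs.
have [l hl] : exists l : 'I_L,
    hs2 (denoise_mx (es l.+1) (tensor_conj f)) - hs2 (denoise_mx (es l) (tensor_conj f))
      <= L%:R^-1.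
  apply: (pigeonhole (u := fun l => hs2 (denoise_mx (es l) (tensor_conj f)))) => //.
    exact: hs2_ge0.
  by have [h _] := esP L; exact: (hs2_A_le1 ch_onb ch_inj chs f1 h).
set eps := es l in hl; set eps' := es l.+1 in hl.
have [eps0 eps1] : 0 < eps /\ eps <= 1 := esP l.
have [eps'0 eps'e hth hsg] : [/\ 0 < eps', eps' <= eps,
    forall j, eps^-1 * ((1 + eps^-1 ^+ (2 * (N j).1)) ^+ (4 * (N j).2) * eps') <= xi &
    eps^-1 * ((1 + eps^-1) ^+ (2 * k) * eps') <= xi].
  exact: next_epsP.
set A := denoise_mx eps (tensor_conj f).
have Edelta : hs2 (subk (denoise_mx eps' (tensor_conj f)) A) <= delta ^+ 2.
  apply: le_trans (hs2_denoise_sub ch_onb ch_inj chs _ eps'0 eps'e) _.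
  exact: le_trans hl hL.
have hA : hermitian_kernel A := hermitian_denoise ch_inj chs eps f.
have [e [lam [e_onb eA]]] := spectral_kernel hA.
have lamg : forall i, - sigma < lam i.
  apply: (eigenvalue_gt ch_onb ch_inj chs f1 eps0 eps'0 (ltW delta0) Edelta e_onb eA
    k0 sg0).
  have : (2 * k)%:R^-1 <= k%:R^-1 :> R.
    by rewrite lef_pV2 ?posrE ?ltr0n ?muln_gt0 // ler_nat leq_pmull.
  have : 0 < sigma ^+ 2 by rewrite exprn_gt0.
  lra.
have fle1 := sqn_f_le1 f1.
(* Cumulative spectral mass of [f]; its increments over the windows [[a j, a j.+1)] add up to at
   most 1. *)
pose F x := \sum_(i | lam i < x) normc (inner f (e i)) ^+ 2.
have F0 x : 0 <= F x by rewrite sumr_ge0 // => i _; rewrite sqr_ge0.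
have [j hj] : exists j : 'I_n, F (a j.+1) - F (a j) <= n%:R^-1.
  apply: (pigeonhole (u := fun j => F (a j))) => //.
  apply: le_trans fle1; rewrite (parseval_sqn f e_onb).
  rewrite [leRHS](bigID (fun i => lam i < a n)) /=.
  by rewrite lerDl sumr_ge0 // => i _; rewrite sqr_ge0.
set b := a j.+1 in hj.
have b_lo : lo <= b := a_lo _.
have b_hi : b <= hi by apply: a_hi; exact: ltn_ord.
have b0 : 0 < b by exact: lt_le_trans lo0 b_lo.
have b6 : lo ^+ 6 <= b ^+ 6 by rewrite lerXn2r ?nnegrE ?(ltW b0) ?(ltW lo0).
exists b, eps; split.
- by rewrite b_lo.
- by rewrite eps1 andbT; apply: eps_seq_nonincreasing => //; exact: ltnW.
exists (freg f e lam b).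
have [h1 h2] := hN j.
have U : u3 ch (fun x => f x - freg f e lam b x) <= 256 * b ^+ 3.
  apply: (u3_sub_freg ch_onb ch_inj chs f1 eps0 eps1 eps'0 (ltW delta0) Edelta e_onb eA
    (lt_le_trans lo0 (a_lo j)) (aS j) _ _ _ h1 h2 (mu := lo ^+ 6 / 2) _ _ lamg (ltW sg0)).
  - by rewrite (le_trans b_hi) // ltW.
  - by rewrite /kappa; lra.
  - by rewrite -/b /kappa; lra.
  - apply: le_trans nmass; apply: le_trans hj.
    rewrite lerBrDr addrC /F [leRHS](bigID (fun i => lam i < a j)) /=.
    rewrite le_eqVlt; apply/orP; left; apply/eqP; congr (_ + _).
      apply: eq_bigl => i; rewrite andbC; case: ltP => // h.
      by rewrite (lt_trans h).
    by apply: eq_bigl => i; rewrite -leNgt andbC.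
  - apply: le_trans b6; rewrite /kappa.
    have : lo ^+ 6 * lo ^+ 6 <= lo ^+ 6 * 1 by rewrite ler_pM2l // (le_trans l61).
    by move: (lo ^+ 6) => y h; nra.
  - by apply: le_trans (a_lo j); rewrite /sigma; lra.
  - by apply: le_trans b6; have := hth j; rewrite /sigma; lra.
  - by apply: le_trans b_lo; have := hth j; lra.
split.
- exact: freg_projection.
- rewrite (gowers3E _ ch_onb chD).
  (* The norm is the eighth root of [u3], and 256 is the eighth power of 2. *)
  have -> : 2 * (b `^ (3 / 8)) = (256 * b ^+ 3) `^ (8^-1).
    rewrite powRM ?exprn_ge0 ?(ltW b0) //; congr (_ * _).
      have -> : 256 = (2 : R) `^ 8%:R by rewrite powR_mulrn //; ring.
      by rewrite -powRrM mulfV ?pnatr_eq0 // powRr1.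
    by rewrite -powR_mulrn ?(ltW b0) // -powRrM.
  apply: ge0_ler_powR; rewrite ?nnegrE ?invr_ge0 ?ler0n ?u3_ge0 //.
  by rewrite mulr_ge0 // exprn_ge0 // ltW.
- apply: ge_ereal_sup => _ [g /= g1 <-]; rewrite lee_fin.
  have {}g1 := gowers3_le1 ch_onb chD g1.
  (* The structured part is [A w] with [sqn w <= b^-1 ^+ 2], so [u3 w <= b^-1 ^+ 8], and the eighth
     root of the resulting bound is [eps^-1 * b^-1]. *)
  have [w wE wb] := freg_app f e_onb hA eA b0.
  rewrite (eq_inner wE (frefl g)).
  have H := inner_app_denoise ch_onb ch_inj chs g w eps0 fle1.
  have eiP : 0 <= eps^-1 by rewrite invr_ge0 ltW.
  apply: le_trans (_ : eps^-1 * b^-1 <= _); last first.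
    have [eL _] := esP L.
    apply: ler_pM => //; first by rewrite invr_ge0 ltW.
      rewrite lef_pV2 ?posrE //.
      by apply: eps_seq_nonincreasing => //; exact: ltnW.
    by rewrite lef_pV2 ?posrE.
  rewrite -(@ler_pXn2r _ 8) ?nnegrE ?normc_ge0 ?mulr_ge0 ?invr_ge0 ?(ltW b0) ?(ltW eps0) //.
  apply: le_trans H _; rewrite exprMn ler_wpM2l ?exprn_ge0 //.
  apply: le_trans (_ : 1 * (b^-1 ^+ 2) ^+ 4 <= _); last by rewrite mul1r -exprM.
  apply: ler_pM; rewrite ?u3_ge0 //.
  apply: le_trans (u3_le_sqn ch_onb chs w) _.
  rewrite lerXn2r ?nnegrE ?sqn_ge0 ?sqr_ge0 //.
  by apply: le_trans wb _; rewrite ler_piMr ?sqr_ge0.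
Qed.

End Final.

(** * Making the dual norm bound depend on the eigenvalue threshold alone *)

Theorem theorem1p1 (R : realType) :
  exists bound : R -> R,
  forall rho0 : R, 0 < rho0 -> rho0 < 1 ->
  exists2 eps0 : R, 0 < eps0 &
  forall (Z : finZmodType) (f : Z -> complex R), one_bounded f ->
  exists rho eps : R,
    [/\ rho0 / 2 <= rho <= rho0,
        eps0 <= eps <= 1 &
        exists freg : Z -> complex R,
          [/\ is_orthogonal_projection
                (spectral_space (denoise_mx eps (tensor_conj f)) rho) f freg,
              gowers_norm 3 (f \- freg) <= 2 * (rho `^ (3 / 8)) &
              exists h : Z -> complex R,
                norm2 (freg \- h) <= rho /\
                (gowers_dual_norm 3 h <= (bound rho)%:E)%E]].
Proof.
(* The windows [[q ^+ k / 2, q ^+ k.+1]] are nondegenerate because [q > 1 / 2], and the one with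
   [q ^+ k.+1 <= rho0 <= q ^+ k] lies in [[rho0 / 2, rho0]]. Thus countably many windows serve all
   [rho0]. *)
pose q : R := 3 / 4.
have q0 : 0 < q by rewrite /q; lra.
have q1 : q < 1 by rewrite /q; lra.
pose lo k : R := q ^+ k / 2; pose hi k : R := q ^+ k.+1.
have lo0 k : 0 < lo k by rewrite divr_gt0 // exprn_gt0.
have /choice[e0 he] (k : nat) : exists e0 : R, 0 < e0 /\
  forall (Z : finZmodType) (f : Z -> complex R), one_bounded f ->
  exists rho eps : R, [/\ lo k <= rho <= hi k, e0 <= eps <= 1 &
  exists fr : Z -> complex R,
  [/\ is_orthogonal_projection
        (spectral_space (denoise_mx eps (tensor_conj f)) rho) f fr,
      gowers_norm 3 (f \- fr) <= 2 * (rho `^ (3 / 8)) &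
      (gowers_dual_norm 3 fr <= (e0^-1 * (lo k)^-1)%:E)%E]].
  have qk : 0 < q ^+ k by rewrite exprn_gt0.
  have [|||e h h'] := @regularity R (lo k) (hi k); first exact: lo0.
  - by rewrite /lo /hi exprS /q in qk *; lra.
  - by rewrite exprn_ilt1 // ltW.
  by exists e.
have small x : exists N, 0 < x -> q ^+ N < x.
  have [x0|] := ltP 0 x; last by exists 0%N.
  have [|N hN] := @expr_unbounded R q^-1 (x^-1 + 1); first by rewrite invf_gt1.
  exists N => _; rewrite -[x]invrK -[ltLHS]invrK ltf_pV2 ?posrE ?invr_gt0 ?exprn_gt0 //.
  by rewrite -exprVn; lra.
have [N hN] := choice small.
(* If [rho] lies in window [k], then [rho <= q ^+ k.+1], which forces [k < N rho]. Summing the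
   constants of all such windows removes the dependence on [k]. *)
exists (fun x => \sum_(k < N x) (e0 k)^-1 * (lo k)^-1) => rho0 r0 r1.
have exk : exists k, q ^+ k.+1 <= rho0.
  exists (N rho0); apply: le_trans (ltW (hN _ r0)).
  by rewrite exprS ler_piMl ?exprn_ge0 // ltW.
(* Minimality of [k] gives [rho0 <= q ^+ k]; for [k = 0] this is [rho0 < 1]. *)
have [k hk kmin] := ex_minnP exk.
have rk : rho0 <= q ^+ k.
  case: k hk kmin => [|k] hk kmin; first by rewrite expr0 ltW.
  by rewrite leNgt; apply/negP => /ltW /kmin; rewrite ltnn.
have [ek H] := he k; exists (e0 k) => // Z f f1.
have [rho [eps [/andP[rlo rhi] he' [fr [P1 P2 P3]]]]] := H Z f f1.
have rho_gt0 : 0 < rho by exact: lt_le_trans (lo0 k) rlo.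
exists rho, eps; split=> //.
  rewrite (le_trans rhi hk) andbT; apply: le_trans rlo; rewrite /lo; lra.
(* The structured part itself serves as [h], with L^2 error 0. *)
exists fr; split=> //; exists fr; split.
  rewrite /norm2 (innerxx (fr \- fr)) /= (_ : sqn _ = 0).
    by rewrite sqrtr0 ltW.
  rewrite /sqn /avgr big1 ?mulr0 // => x _.
  by rewrite /= subrr ComplexField.Normc.normc0 expr0n.
apply: le_trans P3 _; rewrite lee_fin.
have kN : (k < N rho)%N.
  rewrite ltnNge; apply/negP => Nk; have := hN _ rho_gt0; apply/negP; rewrite -leNgt.
  apply: le_trans rhi _; apply: ler_wiXn2l; rewrite ?(ltW q0) ?(ltW q1) //.
  exact: leq_trans Nk _.
rewrite (bigD1 (Ordinal kN)) //= lerDl sumr_ge0 // => i _.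
by have [ei _] := he i; rewrite mulr_ge0 ?invr_ge0 ?ltW.
Qed.
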